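(* Let $T^+=(T^+(s))_{s\in[0,t]}$ be a telegraph meander with parameters $\lambda>0$, $c>0$, $t>0$. Then, for every real $p>0$, $$\mathsf{E}\big[T^+(t)^p\big]=\Big(\frac{2c^2t}{\lambda}\Big)^{\frac p2}\,\frac{\Gamma\big(\frac p2+1\big)\big(I_{\frac p2}(\lambda t)+I_{\frac p2-1}(\lambda t)\big)-\frac p2\,\Gamma\big(\frac{p+1}{2}\big)\sqrt{\frac{2}{\lambda t}}\;I_{\frac{p-1}{2}}(\lambda t)}{I_0(\lambda t)+I_1(\lambda t)}.$$
   Context: Let $N$ be a homogeneous Poisson process of rate $\lambda>0$, and let $V(0)$ be independent of $N$ and uniformly distributed on $\{-c,c\}$, $c>0$. Set $V(s)=V(0)(-1)^{N(s)}$ and $T(s)=\int_0^sV(u)\,du$ (telegraph process). The telegraph meander $T^+$ on $[0,t]$ is the random continuous function on $[0,t]$ whose law is that of $(T(s))_{0\le s\le t}$ conditioned on $\{\min_{0\le s\le t}T(s)\ge0\}$; in particular the law of $T^+(t)$ is the conditional law of $T(t)$ given $\min_{0\le s\le t}T(s)\ge0$. $I_\nu(x)=\sum_{k\ge0}(x/2)^{2k+\nu}\frac{1}{k!\,\Gamma(\nu+k+1)}$ is the modified Bessel function of the first kind of real order $\nu$. *)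

(* Defs.v *)
From HB Require Import structures.
From mathcomp Require Import all_boot all_order all_algebra.
From mathcomp Require Import all_classical all_reals all_analysis.

Set Implicit Arguments.
Unset Strict Implicit.
Unset Printing Implicit Defensive.

Import Order.TTheory GRing.Theory Num.Theory.
Import numFieldNormedType.Exports.

Local Open Scope classical_set_scope.
Local Open Scope ring_scope.

Section special_functions.
Context {R : realType}.
Implicit Types (x a nu : R) (k n : nat).

Definition euler_gamma a : R :=
  \int[lebesgue_measure]_(x in `]0, +oo[) (x `^ (a - 1) * expR (- x)).

(* For a <= 0, Gamma(a) = Gamma(a + n) / (a (a + 1) ... (a + n - 1)) with n the
   least natural number such that a + n > 0. At the poles 0, -1, -2, ... the
   denominator vanishes, so that Gamma(a) and its inverse are both 0; the value
   0 for 1 / Gamma(a) is the usual convention. *)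
Definition gamma_shift a : nat :=
  if 0 < a then 0%N else (Num.truncn (- a)).+1.

Definition Gamma a : R :=
  euler_gamma (a + (gamma_shift a)%:R) /
  \prod_(i < gamma_shift a) (a + i%:R).

Definition besselI_term nu x k : R :=
  (x / 2) `^ (2 * k%:R + nu) / (k`!%:R * Gamma (nu + k%:R + 1)).

Definition besselI nu x : R := limn (series (besselI_term nu x)).

End special_functions.

(* The sigma-algebra on paths generated by the evaluations at the times in D.
   On continuous paths over a segment it is the trace of the Borel sigma-algebra
   of the topology of uniform convergence. *)
Definition cylinder_sigma {R : realType} {d : measure_display}
    {E : measurableType d} (D : set R) : set (set (R -> E)) :=
  <<s [set C | exists2 s, D s &
        exists2 A : set E, measurable A & C = [set f | A (f s)]] >>.

Section probability_notions.
Context {d : measure_display} {Omega : measurableType d} {R : realType}.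
Variable P : probability Omega R.

Definition cond_prob (A B : set Omega) : \bar R := (P (A `&` B) / P B)%E.

(* Taking some of the A i equal to setT gives the product rule for every
   subfamily. *)
Definition mutually_independent {d' : measure_display} {E : measurableType d'}
    (n : nat) (X : 'I_n -> Omega -> E) : Prop :=
  forall A : 'I_n -> set E, (forall i, measurable (A i)) ->
    P (\bigcap_(i in [set: 'I_n]) (X i @^-1` A i)) =
    (\prod_(i < n) P (X i @^-1` A i))%E.

(* Only the times s >= 0 matter. *)
Record poisson_process (lambda : R) (N : R -> Omega -> nat) : Prop := {
  poisson_measurable : forall s, 0 <= s -> measurable_fun setT (N s) ;
  poisson_start : forall w, N 0 w = 0%N ;
  poisson_nondecreasing : forall w s u, 0 <= s -> s <= u ->
    (N s w <= N u w)%N ;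
  poisson_right_continuous : forall w s, 0 <= s ->
    \forall u \near s^'+, N u w = N s w ;
  poisson_increments : forall s u k, 0 <= s -> s < u ->
    P [set w | (N u w - N s w)%N = k] =
    (poisson_pmf (lambda * (u - s)) k)%:E ;
  poisson_independent_increments : forall n (s : nat -> R),
    0 <= s 0%N -> nondecreasing_seq s ->
    mutually_independent (fun (i : 'I_n) w => (N (s i.+1) w - N (s i) w)%N)
}.

Definition uniform_sign (c : R) (V0 : Omega -> R) : Prop :=
  [/\ measurable_fun setT V0,
      P [set w | V0 w = c] = (2^-1)%:E &
      P [set w | V0 w = - c] = (2^-1)%:E].

Definition independent_of_process {d1 d2 : measure_display}
    {E1 : measurableType d1} {E2 : measurableType d2}
    (X : Omega -> E1) (Y : R -> Omega -> E2) : Prop :=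
  forall (A : set E1) (C : set (R -> E2)),
    measurable A -> cylinder_sigma `[0, +oo[ C ->
    P [set w | A (X w) /\ C (Y ^~ w)] =
    (P [set w | A (X w)] * P [set w | C (Y ^~ w)])%E.

End probability_notions.

Section telegraph.
Context {R : realType}.

Section process.
Context {Omega : Type}.
Variables (N : R -> Omega -> nat) (V0 : Omega -> R).

Definition velocity (s : R) (w : Omega) : R := V0 w * (- 1) ^+ N s w.

Definition telegraph (s : R) (w : Omega) : R :=
  \int[lebesgue_measure]_(u in `[0, s]) velocity u w.

Definition telegraph_nonneg (t : R) : set Omega :=
  [set w | forall s, 0 <= s <= t -> 0 <= telegraph s w].

End process.

Record telegraph_meander {d d' : measure_display} {Omega : measurableType d}
    {Omega' : measurableType d'} (P : probability Omega R)
    (N : R -> Omega -> nat) (V0 : Omega -> R) (t : R)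
    (P' : probability Omega' R) (Tp : R -> Omega' -> R) : Prop := {
  meander_measurable : forall s, 0 <= s <= t -> measurable_fun setT (Tp s) ;
  meander_continuous : forall w, {within `[0, t], continuous (Tp ^~ w)} ;
  meander_law : forall C : set (R -> R), cylinder_sigma `[0, t] C ->
    P' [set w | C (Tp ^~ w)] =
    cond_prob P [set w | C (telegraph N V0 ^~ w)] (telegraph_nonneg N V0 t)
}.

End telegraph.

(* Main.v *)
(* The expectation under the meander law is a quotient of two integrals of
   max(T(t), 0)^p over {min T >= 0}, at the given p and at p = 0. Observed on a
   grid of mesh h, the telegraph process is a +-1 walk driven by the increments
   of N; up to an event of vanishing probability each increment is 0 or 1, and
   a path with n switches then has probability e^(- lambda t) (lambda h)^n. The
   nonnegative walks with n switches and a given endpoint are counted by the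
   reflection principle, so that the moments carried by n switches become, as
   h -> 0, Riemann sums of Beta integrals. Summing over n (Tannery's theorem)
   gives a power series in lambda t whose even and odd parts are the Bessel
   series. The walk is compared with T pathwise: walks above 0 bound the
   integral from below, walks above a barrier that is lower than the
   discretisation error but tends to 0 bound it from above. *)

Require Import Defs.
From HB Require Import structures.
From mathcomp Require Import all_boot all_order all_algebra.
From mathcomp Require Import zify ring lra.
From mathcomp Require Import all_classical all_reals all_analysis.
From mathcomp Require Import measurable_realfun.

Set Implicit Arguments.
Unset Strict Implicit.
Unset Printing Implicit Defensive.

Import Order.TTheory GRing.Theory Num.Theory.
Import numFieldNormedType.Exports.

(** * Counting sign paths *)

(** The law of the Poisson process is given through its increments, so working with jump times would
    first require their joint law; a grid needs nothing beyond independent increments. The price is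
    a two-sided comparison, and it stays cheap because both sides use one count: r initial rising
    steps turn a barrier at -r into a barrier at 0, so the upper and the lower bound have the same
    limit. A path with two jumps in one cell matches no walk. Such paths are controlled through the
    total mass of all walks, (e^(-y) (1 + y))^m with y = lambda h and m about t / h, which tends to
    1. Paths with initial velocity -c become negative at once, which is why all walks start upwards
    and a factor 1/2 appears; it cancels in the quotient. The normalisation p = 0 needs its own
    identification with Bessel functions, because the order p/2 - 1 then reaches -1, where Gamma has
    a pole in the first term. *)

Fixpoint bits (m : nat) : seq (seq bool) :=
  if m is m'.+1 then map (cons true) (bits m') ++ map (cons false) (bits m')
  else [:: [::]].

(* A word records at which grid points the walk switches direction, the latest
   first: a word of size m encodes a walk of m + 1 steps that starts upwards,
   [ups] counts its rising steps, and [above r] says that it stays >= - r. *)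
Definition flips (s : seq bool) : nat := count id s.

Fixpoint ups (s : seq bool) : nat :=
  if s is _ :: s' then (ups s' + ~~ odd (flips s))%N else 1%N.

Fixpoint above (r : nat) (s : seq bool) : bool :=
  if s is _ :: s' then
    above r s' && ((size s).+1 <= (ups s).*2 + r)%N
  else true.

Lemma mem_bits m s : (s \in bits m) = (size s == m).
Proof.
elim: m s => [|m IH] [|b s] //=.
- by rewrite mem_cat; apply/negP => /orP[] /mapP[].
- rewrite mem_cat eqSS -IH; case: b; rewrite mem_map; try by move=> ? ? [].
  + apply/idP/idP => [/orP[]//|->//]; by move=> /mapP[].
  + apply/idP/idP => [/orP[]//|->]; last by rewrite orbT.
    by move=> /mapP[].
Qed.

Lemma uniq_bits m : uniq (bits m).
Proof.
elim: m => //= m IH; rewrite cat_uniq !map_inj_uniq ?IH /=; try by move=> ? ? [].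
by rewrite andbT; apply/hasPn => _ /mapP[s _ ->]; apply/mapP => -[].
Qed.

Lemma big_bits (V : nmodType) m (F : seq bool -> V) :
  (\sum_(s <- bits m.+1) F s =
   \sum_(s <- bits m) F (true :: s) + \sum_(s <- bits m) F (false :: s))%R.
Proof. by rewrite /= big_cat !big_map. Qed.

Lemma ups_le s : (ups s <= (size s).+1)%N.
Proof. by elim: s => //= b s; case: odd => /=; lia. Qed.

Definition npaths (m n U : nat) : nat :=
  \sum_(s <- bits m) [&& flips s == n, ups s == U & above 0 s].

Lemma npaths0 n U : npaths 0 n U = ((n == 0) && (U == 1)).
Proof.
by rewrite /npaths big_seq1 /= andbT eq_sym [1 == U]eq_sym.
Qed.

(** The end point is [2 U - (m + 2)]. The last step rises exactly when the total number of switches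
    is even, and staying above 0 adds only the condition on the new end point. Storing the latest
    letter first makes this a recursion on the head. *)
Lemma npathsS m n U : npaths m.+1 n U =
  if (m.+2 <= U.*2)%N then
    npaths m n (U - ~~ odd n) + (if n is n'.+1 then npaths m n' (U - ~~ odd n) else 0)
  else 0.
Proof.
have shift s b : size s = m ->
    [&& flips (b :: s) == n, ups (b :: s) == U & above 0 (b :: s)] =
    (m.+2 <= U.*2)%N && [&& (b + flips s)%N == n, ups s == U - ~~ odd n & above 0 s].
  move=> sm; rewrite [flips _]/= -/(flips s) /= -/(flips s); case: eqP => [->|_]; last by rewrite andbF.
  rewrite sm addn0; case: (leqP m.+2 U.*2) => hU.
    have -> : (ups s + ~~ odd n == U) = (ups s == U - ~~ odd n).
      by apply/eqP/eqP; case: odd => /=; lia.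
    case: eqP => [e|]; rewrite /= ?andbF//.
    have -> : (ups s + ~~ odd n = U)%N by move: e; case: odd => /=; lia.
    by rewrite hU andbT.
  by rewrite /= andbC; case: eqP => [->|]; rewrite ?andbF// leqNgt hU andbF.
rewrite {1}/npaths (big_bits (V := nat)) addrC.
case: ifPn => hU; last first.
  rewrite !big_seq !big1// => s; rewrite mem_bits => /eqP sm;
    by rewrite shift// (negbTE hU).
congr (_ + _)%N.
  rewrite /npaths !big_seq; apply: eq_bigr => s; rewrite mem_bits => /eqP sm.
  by rewrite shift// hU.
case: n shift => [|n] shift.
  by rewrite big1.
rewrite /npaths !big_seq; apply: eq_bigr => s; rewrite mem_bits => /eqP sm.
by rewrite shift// hU add1n eqSS.
Qed.

Lemma npaths_low m n U : (U.*2 < m.+1)%N -> npaths m n U = 0.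
Proof.
case: m => [|m] h; first by rewrite npaths0; case: U h => // ?; rewrite andbF.
by rewrite npathsS; case: ifPn => //; lia.
Qed.

Lemma npaths_noflip m U : npaths m 0 U = (U == m.+1).
Proof.
elim: m U => [|m IH] U; first by rewrite npaths0.
rewrite npathsS addn0 IH /=; case: ifPn => h.
  by congr nat_of_bool; apply/eqP/eqP; lia.
by apply/esym/eqP; rewrite eqb0; apply/eqP; lia.
Qed.

Lemma npaths_high m n U : (m < U)%N -> npaths m n.+1 U = 0.
Proof.
elim: m n U => [|m IH] n U h; first by rewrite npaths0.
rewrite npathsS; case: ifPn => // _; rewrite IH; last by lia.
case: n => [|n]; last by rewrite IH //=; lia.
by rewrite npaths_noflip /=; lia.
Qed.

(* The subtracted products count the paths reflected at their first passage
   below 0; putting them on the left avoids truncated subtraction. *)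
Lemma npathsE a b k : (b <= a)%N ->
  npaths (a + b).+1 k.*2.+1 a.+1 +
    (if k is k'.+1 then 'C(a, k') else 0) * 'C(b, k.+1) = 'C(a, k) * 'C(b, k) /\
  npaths (a + b).+1 k.*2.+2 a.+1 + 'C(a, k) * 'C(b, k.+1) = 'C(a, k.+1) * 'C(b, k).
Proof.
(* There are [a.+1] rising and [b.+1] falling steps; 'C(a, k) and 'C(b, k) count the ways to cut
   each kind into [k.+1] runs. No bijection is built: removing the last step exchanges the two
   parities, so both identities are proved together, by Pascal's rule. *)
move: {2}(a + b)%N (erefl (a + b)%N) => m; elim: m a b k => [|m IH] a b k mE ba.
  have [-> ->] : a = 0 /\ b = 0 by lia.
  rewrite /= addn0 !bin0n !npathsS /= !npaths0 /=.
  by case: k => [|k]; split; rewrite /= ?muln0 ?mul0n.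
split.
  rewrite npathsS; case: ifPn => hU; last by lia.
  rewrite /= negbK odd_double subn0.
  (* With a single falling step the path before it only rises, hence has no switch. *)
  case: b => [|b] in mE ba hU *.
        rewrite addn0 npaths_high// add0n !bin0n.
    case: k => [|k]; last by rewrite npaths_high//; lia.
    by rewrite npaths_noflip bin0 eqxx.
  rewrite addnS; have [IH1 _] := IH a b k ltac:(lia) ltac:(lia).
  case: k => [|k] in IH1 *.
    rewrite npaths_noflip /= !bin0 in IH1 *; lia.
  have [_ IH2] := IH a b k ltac:(lia) ltac:(lia).
  rewrite doubleS in IH1 *; rewrite binS [X in _ = _ * X]binS !mulnDr; lia.
rewrite npathsS; case: ifPn => hU; last by lia.
rewrite /= negbK odd_double subn1 /=.
(* For [a = b] the walk ends at 0 with a rising step, so it would have come from -1: there is no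
   such path, and the two products agree. *)
have [ab|ab] := eqVneq a b.
  subst b; rewrite !npaths_low; try lia.
case: a => [|a] in mE ba hU ab *; first by lia.
rewrite addSn.
have [IH1 IH2] := IH a b k ltac:(lia) ltac:(lia).
rewrite [X in _ = X * _]binS !mulnDl.
case: k => [|k] in IH1 IH2 *; first by rewrite !bin0 /= in IH1 IH2 *; lia.
rewrite [X in _ + X * _ = _]binS !mulnDl; lia.
Qed.

Lemma npaths_total m n : \sum_(s <- bits m) (flips s == n) = 'C(m, n).
Proof.
elim: m n => [|m IH] n; first by rewrite big_seq1; case: n.
rewrite (big_bits (V := nat)) addrC.
case: n => [|n]; last by rewrite binS -(IH n.+1) -(IH n).
by rewrite [X in (_ + X)%R]big1// addr0 bin0 -(bin0 m) -IH.
Qed.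

(** The tail of a word is its beginning in time: appending [nseq r false] inserts r initial rising
    steps, which keeps the switches and lifts the rest of the walk by r. *)
Lemma flips_cat_nseq s r : flips (s ++ nseq r false) = flips s.
Proof. by rewrite /flips count_cat count_nseq mul0n addn0. Qed.

Lemma ups_cat_nseq s r : ups (s ++ nseq r false) = (ups s + r)%N.
Proof.
elim: s => [|b s IH] /=; last first.
  by rewrite -/(flips _) flips_cat_nseq IH; lia.
by elim: r => //= r ->; rewrite /flips /= count_nseq mul0n; lia.
Qed.

Lemma above_cat_nseq s r : above 0 (s ++ nseq r false) = above r s.
Proof.
elim: s => [|b s IH] /=; last first.
  rewrite IH -/(flips _) flips_cat_nseq ups_cat_nseq size_cat size_nseq.
  by congr andb; lia.
elim: r => //= r ->; rewrite /flips /= count_nseq mul0n size_nseq.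
by have := ups_cat_nseq [::] r; rewrite /= => ->; lia.
Qed.

Lemma sum_bits_cat_nseq (K : numDomainType) m r (F : seq bool -> K) :
  (forall s, 0 <= F s)%R ->
  (\sum_(s <- bits m) F (s ++ nseq r false) <= \sum_(s <- bits (m + r)) F s)%R.
Proof.
elim: m F => [|m IH] F F0.
  rewrite big_seq1 add0n /= (bigD1_seq (nseq r false)) ?uniq_bits//=; last first.
    by rewrite mem_bits size_nseq.
  by rewrite lerDl sumr_ge0.
by rewrite addSn !big_bits lerD// (IH (fun s => F (_ :: s))).
Qed.

Lemma sum_bits_flips (K : comNzRingType) m (y : K) :
  (\sum_(s <- bits m) y ^+ flips s = (1 + y) ^+ m)%R.
Proof.
elim: m => [|m IH]; first by rewrite big_seq1.
rewrite big_bits exprS mulrDl mul1r addrC -IH mulr_sumr; congr (_ + _)%R.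
by apply: eq_bigr => s _; rewrite /flips/= -/(flips s) exprS.
Qed.

Local Open Scope classical_set_scope.
Local Open Scope ring_scope.

(** * Gamma and Beta integrals *)

Section gamma.
Context {R : realType}.
Implicit Types a x : R.
Local Notation mu := (@lebesgue_measure R).

Let G a : \bar R := (\int[mu]_(x in `]0%R, +oo[) (x `^ (a - 1) * expR (- x))%:E)%E.

(** Compact exhaustion of the half-line that avoids the singularity at 0, so that integration by
    parts applies; starting at 2 keeps the lower end strictly below the upper one. *)
Let K (n : nat) : set R := `[(n.+2%:R)^-1, n.+2%:R].

Let bigcup_K : \bigcup_n K n = `]0%R, +oo[%classic.
Proof.
apply/seteqP; split => x /=.
  move=> [n _]; rewrite /K/= !in_itv/= andbT => /andP[h _].
  by apply: lt_le_trans h; rewrite invr_gt0.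
rewrite in_itv/= andbT => x0.
have [n hn] : exists n : nat, x <= n%:R /\ x^-1 <= n%:R.
  exists (maxn (Num.truncn x).+1 (Num.truncn x^-1).+1).
  split; apply/ltW; [have := truncnS_gt x|have := truncnS_gt x^-1];
    by move=> /lt_le_trans; apply; rewrite ler_nat leq_max leqnn ?orbT.
exists n => //; rewrite /K/= in_itv/=; apply/andP; split.
  rewrite -[leRHS]invrK lef_pV2 ?posrE ?invr_gt0//.
  by rewrite (le_trans hn.2)// ler_nat; lia.
by rewrite (le_trans hn.1)// ler_nat; lia.
Qed.

Let nd_K : nondecreasing_seq K.
Proof.
move=> m n mn; rewrite subsetEset; apply: subset_itv; rewrite bnd_simp.
- by rewrite lef_pV2 ?posrE// ler_nat; lia.
- by rewrite ler_nat; lia.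
Qed.

Let cexpN : continuous (fun x : R => expR (- x)).
Proof.
move=> z; apply: continuous_comp; last exact: continuous_expR.
exact: (@continuousN _ R^o).
Qed.

Let mG a D : measurable_fun D (fun x : R => x `^ (a - 1) * expR (- x)).
Proof.
apply: measurable_funTS; apply: measurable_funM; first exact: measurable_powR.
exact: continuous_measurable_fun.
Qed.

Let G_ge0 a x : 0 <= x `^ (a - 1) * expR (- x).
Proof. by rewrite mulr_ge0 ?powR_ge0 ?expR_ge0. Qed.

Let cvg_G a :
  (\int[mu]_(x in K n) (x `^ (a - 1) * expR (- x))%:E @[n --> \oo] --> G a)%E.
Proof.
rewrite /G -bigcup_K; apply: ge0_nondecreasing_set_cvg_integral => //.
- by move=> i; exact: measurable_itv.
- by move=> i; apply: measurableT_comp => //; exact: mG.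
- by move=> i x _; rewrite lee_fin.
Qed.

Let K_parts a n : 0 < a ->
  (\int[mu]_(x in K n) (x `^ (a + 1 - 1) * expR (- x))%:E =
   ((n.+2%:R)^-1 `^ a * expR (- (n.+2%:R)^-1) - (n.+2%:R) `^ a * expR (- n.+2%:R))%:E
   + a%:E * \int[mu]_(x in K n) (x `^ (a - 1) * expR (- x))%:E)%E.
Proof.
move=> a0.
have l0 : 0 < (n.+2%:R : R)^-1 by rewrite invr_gt0.
have ll : (n.+2%:R : R)^-1 < n.+2%:R.
  by rewrite (@lt_trans _ _ 1)// ?invf_lt1// ltr1n.
have Kpos x : K n x -> 0 < x.
  by rewrite /K/= in_itv/= => /andP[h _]; exact: lt_le_trans h.
have cpow (b x : R) : 0 < x -> {for x, continuous (fun x : R => x `^ b)}.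
  move=> x0; apply: differentiable_continuous; apply/derivable1_diffP.
  by apply: derivable_powR; rewrite in_itv/= x0.
have := @integration_by_parts R (fun x => x `^ a) (fun x => - expR (- x))
  (fun x => a * x `^ (a - 1)) (fun x => expR (- x)) _ _ ll.
rewrite addrK => ->.
- congr (_ + _)%E; first by congr EFin; ring.
  transitivity (- (\int[mu]_(x in K n) ((- a)%:E * (x `^ (a - 1) * expR (- x))%:E)))%E.
    by congr (- _)%E; apply: eq_integral => x _; rewrite -EFinM; congr EFin; ring.
  rewrite integralZl//= ?EFinN ?mulNe ?oppeK//; first exact: measurable_itv.
  apply: continuous_compact_integrable; first exact: segment_compact.
  apply: continuous_in_subspaceT => x; rewrite inE => /Kpos x0.
  by apply: cvgM; [exact: cpow|exact: cexpN].
- apply: continuous_in_subspaceT => x; rewrite inE => /Kpos x0.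
  by apply: cvgM; [exact: cvg_cst|exact: cpow].
- split.
  + move=> x; rewrite in_itv/= => /andP[h _].
    by apply: derivable_powR; rewrite in_itv/= (lt_trans l0 h).
  + by apply: cvg_at_right_filter; exact: cpow.
  + by apply: cvg_at_left_filter; apply: cpow.
- move=> x; rewrite in_itv/= => /andP[h _].
  by apply: powR_derive1; rewrite in_itv/= (lt_trans l0 h).
- by apply: continuous_subspaceT => x; exact: cexpN.
- split.
  + by move=> x _; exact: ex_derive.
  + by apply: cvg_at_right_filter; apply: cvgN; exact: cexpN.
  + by apply: cvg_at_left_filter; apply: cvgN; exact: cexpN.
- move=> x _; rewrite derive1_comp// derive1N// derive1_id mulN1r derive1_comp//.
  by rewrite derive1N// derive1_id mulrN1 opprK derive1E derive_val.
Qed.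

Let cvg_itv_end a : 0 < a ->
  ((n.+2%:R)^-1 `^ a * expR (- (n.+2%:R)^-1) - (n.+2%:R) `^ a * expR (- n.+2%:R) : R)
    @[n --> \oo] --> (0 : R).
Proof.
move=> a0.
have l0 n : 0 < (n.+2%:R)^-1 :> R by rewrite invr_gt0.
have cl : (n.+2%:R)^-1 `^ a @[n --> \oo] --> (0 : R).
  have /cvg_at_rightP := powR_cvg0 a0; apply; split => //.
  have := @cvg_harmonic R; rewrite -cvg_shiftS; exact.
(* This is e^(b/(2a)) >= b/(2a) raised to the power 2a: the exponential beats b^(2a), which leaves
   b^(-a). *)
have ble (n : nat) : n.+2%:R `^ a * expR (- n.+2%:R) <= (2 * a) `^ (2 * a) * (n.+2%:R)^-1 `^ a :> R.
  set b := n.+2%:R; have b0 : 0 < b :> R by [].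
  have a2 : 0 < 2 * a by rewrite mulr_gt0.
  rewrite expRN ler_pdivrMr ?expR_gt0//.
  have -> : expR b = expR (b / (2 * a)) `^ (2 * a).
    by rewrite [RHS]/powR gt_eqF ?expR_gt0// expRK mulrCA divff ?mulr1// gt_eqF.
  apply: (@le_trans _ _ ((2 * a) `^ (2 * a) * b^-1 `^ a * (b / (2 * a)) `^ (2 * a))).
    have b1 := ltW b0; have a3 := ltW a2.
    rewrite mulrAC -powRM ?divr_ge0// mulrCA divff ?mulr1 ?gt_eqF//.
    rewrite mulrDl mul1r powRD; last by rewrite (gt_eqF b0) implybT.
    by rewrite -mulrA -powRM ?invr_ge0// divff ?gt_eqF// powR1 mulr1.
  apply: ler_wpM2l; first by rewrite mulr_ge0// powR_ge0.
  apply: ge0_ler_powR; rewrite ?nnegrE ?divr_ge0 ?expR_ge0 ?(ltW a2) ?(ltW b0)//.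
  by rewrite ltW// (lt_le_trans _ (expR_ge1Dx _))// ltrDr.
rewrite -[X in _ --> X]subr0; apply: cvgB.
  apply: (squeeze_cvgr _ (cvg_cst 0) cl); apply: nearW => n.
  rewrite mulr_ge0 ?powR_ge0 ?expR_ge0//= ler_piMr ?powR_ge0// expR_le1 oppr_le0.
apply: (squeeze_cvgr _ (cvg_cst 0) (_ : (fun n => (2 * a) `^ (2 * a) * (n.+2%:R)^-1 `^ a) @ \oo --> 0)).
  by apply: nearW => n; rewrite ble mulr_ge0 ?powR_ge0 ?expR_ge0.
by rewrite -[X in _ --> X](mulr0 ((2 * a) `^ (2 * a))); apply: cvgM => //; exact: cvg_cst.
Qed.

Lemma gamma_integralS a : 0 < a -> (G (a + 1) = a%:E * G a)%E.
Proof.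
move=> a0; apply: (@cvg_unique _ (@ereal_hausdorff R) _ _ _ _ (@cvg_G (a + 1))).
rewrite (_ : (fun _ => _) = fun n => (
   ((n.+2%:R)^-1 `^ a * expR (- (n.+2%:R)^-1) - (n.+2%:R) `^ a * expR (- n.+2%:R))%:E
   + a%:E * \int[mu]_(x in K n) (x `^ (a - 1) * expR (- x))%:E)%E); last first.
  by apply/funext => n; exact: K_parts.
rewrite -[(a%:E * G a)%E]add0e.
apply: cvgeD => //.
  apply: cvg_EFin; first exact: nearW.
  exact: cvg_itv_end.
by apply: cvgeZl => //; exact: cvg_G.
Qed.

Lemma gamma_integral1 : G 1 = 1%E.
Proof.
rewrite /G integral_itv_obnd_cbnd; last first.
  by apply: measurableT_comp => //; exact: mG.
under eq_integral do rewrite subrr powRr0 mul1r.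
rewrite (@ge0_continuous_FTC2y _ _ (fun x => - expR (- x)) _ 0)//.

- by rewrite oppr0 expR0 sub0e EFinN oppeK.
- by apply: continuous_subspaceT => x; exact: cexpN.
- by rewrite -oppr0; apply: cvgN; exact: cvgr_expR.
- by apply: cvg_at_right_filter; apply: cvgN; exact: cexpN.
- move=> x _; rewrite derive1_comp// derive1N// derive1_id mulN1r derive1_comp//.
  by rewrite derive1N// derive1_id mulrN1 opprK derive1E derive_val.
Qed.

Let gamma_integral_nat n : (G n.+1%:R = n`!%:R%:E)%E.
Proof.
elim: n => [|n IH]; first by rewrite gamma_integral1.
by rewrite -natr1 gamma_integralS// IH -EFinM -natrM factS.
Qed.

Let G_nneg a : (0 <= G a)%E.
Proof. by apply: integral_ge0 => x _; rewrite lee_fin. Qed.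

Lemma gamma_integral_fin a : 0 < a -> (G a < +oo)%E.
Proof.
(* For b >= 1 the power x^(b-1) is at most 1 + x^(n+1), whose integral is a sum of factorials.
   Smaller arguments follow from the functional equation. *)
have large b : 1 <= b -> (G b < +oo)%E.
  move=> b1; pose n := Num.truncn b.
  have -> // : (G b <= G 1 + G n.+2%:R)%E -> (G b < +oo)%E.
    by move=> /le_lt_trans; apply; rewrite gamma_integral1 gamma_integral_nat -EFinD ltry.
  rewrite /G -ge0_integralD//; last 4 first.
  - by move=> x _; rewrite lee_fin.
  - by apply: measurableT_comp => //; exact: mG.
  - by move=> x _; rewrite lee_fin.
  - by apply: measurableT_comp => //; exact: mG.
  apply: ge0_le_integral => //.
  - by move=> x _; rewrite lee_fin.
  - by apply: measurableT_comp => //; exact: mG.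
  - by apply: emeasurable_funD; apply: measurableT_comp => //; exact: mG.
  move=> x; rewrite /= in_itv/= andbT => x0; rewrite -EFinD lee_fin -mulrDl.
  rewrite ler_wpM2r ?expR_ge0// subrr powRr0.
  have [x1|x1] := leP x 1.
    rewrite (@le_trans _ _ 1) ?lerDl ?powR_ge0//.
    rewrite -[leRHS](powRr0 x); apply: ger_powR; first by rewrite x0.
    by rewrite subr_ge0.
  rewrite (@le_trans _ _ (x `^ (n.+2%:R - 1))) ?lerDr//.
  apply: ler_powR; first exact: ltW.
  by rewrite lerD2r (le_trans (ltW (truncnS_gt _)))// ler_nat.
move=> a0; have [|a1] := leP 1 a; first exact: large.
have := large (a + 1); rewrite lerDr (ltW a0) => /(_ isT).
rewrite gamma_integralS// !ltey; apply: contra => /eqP ->.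
by rewrite gt0_muley// lte_fin.
Qed.

Lemma gamma_integral_gt0 a : 0 < a -> (0 < G a)%E.
Proof.
have large b : 1 <= b -> (0 < G b)%E.
  move=> b1; apply: (@lt_le_trans _ _ (\int[mu]_(x in `[1%R, 2%R]) (cst (expR (- 2))%:E x))%E).
    rewrite integral_cst//= lebesgue_measure_itv/= lte_fin ltr1n/= -EFinB -EFinM lte_fin.
    by rewrite mulr_gt0 ?expR_gt0// subr_gt0 ltr1n.
  apply: (@le_trans _ _ (\int[mu]_(x in `[1%R, 2%R]) (x `^ (b - 1) * expR (- x))%:E)%E).
    apply: ge0_le_integral => //.
    - by move=> x _; rewrite lee_fin expR_ge0.
    - by apply: measurableT_comp => //; exact: mG.
    move=> x; rewrite /= in_itv/= => /andP[x1 x2]; rewrite lee_fin.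
    rewrite -[leLHS]mul1r ler_pM ?expR_ge0// ?ler_expR ?lerN2//.
    by rewrite -[leLHS](powRr0 x) ler_powR// subr_ge0.
  apply: ge0_subset_integral => //.
  - by apply: measurableT_comp => //; exact: mG.
  - by move=> x _; rewrite lee_fin.
  - by move=> x /=; rewrite !in_itv/= andbT => /andP[x1 _]; exact: lt_le_trans x1.
move=> a0; have := large (a + 1); rewrite lerDr (ltW a0) => /(_ isT).
rewrite gamma_integralS// !lt_def G_nneg => /andP[h _]; rewrite andbT.
by apply: contra h => /eqP ->; rewrite mule0.
Qed.

Lemma GammaE a : 0 < a -> Gamma a = fine (G a).
Proof. by move=> a0; rewrite /Gamma /gamma_shift a0 big_ord0 divr1 addr0. Qed.

Lemma Gamma_gt0 a : 0 < a -> 0 < Gamma a.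
Proof.
by move=> a0; rewrite GammaE// fine_gt0// gamma_integral_gt0// gamma_integral_fin.
Qed.

Lemma GammaS a : 0 < a -> Gamma (a + 1) = a * Gamma a.
Proof.
move=> a0; rewrite !GammaE ?addr_gt0// gamma_integralS// fineM//.
by rewrite ge0_fin_numE ?G_nneg// gamma_integral_fin.
Qed.

Lemma Gamma1 : Gamma 1 = 1 :> R.
Proof. by rewrite GammaE// gamma_integral1. Qed.

End gamma.

(** Truncation makes the power monotone and continuous on the whole line for p >= 0. At p = 0 it is
    the constant 1, also at x <= 0, so the same computation yields the probability of the
    conditioning event. *)
Definition pospow {R : realType} (p x : R) : R := Num.max x 0 `^ p.

Section pospow.
Context {R : realType}.
Implicit Types p x y : R.

Lemma pospowE p x : 0 <= x -> pospow p x = x `^ p.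
Proof. by move=> x0; rewrite /pospow max_l. Qed.

Lemma pospow_ge0 p x : 0 <= pospow p x.
Proof. exact: powR_ge0. Qed.

Lemma le_pospow p x y : 0 <= p -> x <= y -> pospow p x <= pospow p y.
Proof.
move=> p0 xy; apply: ge0_ler_powR => //; last by rewrite ge_max !le_max xy lexx orbT.
- by rewrite nnegrE le_max lexx orbT.
- by rewrite nnegrE le_max lexx orbT.
Qed.

Lemma pospowM p x y : 0 <= x -> pospow p (x * y) = x `^ p * pospow p y.
Proof.
move=> x0; rewrite /pospow -powRM ?le_max ?lexx ?orbT//.
by rewrite maxr_pMr// mulr0.
Qed.

Lemma pospow_le1 p x : 0 <= p -> x <= 1 -> pospow p x <= 1.
Proof.
move=> p0 x1; rewrite (le_trans (le_pospow p0 x1))//.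
by rewrite pospowE// powR1.
Qed.

Lemma continuous_pospow p : 0 <= p -> continuous (pospow p).
Proof.
rewrite le_eqVlt => /predU1P[<- x|p0 x].
  rewrite (_ : pospow 0 = cst 1); first exact: cvg_cst.
  by apply/funext => y; rewrite /pospow powRr0.
have [x0|x0|<-] := ltgtP 0 x.
- rewrite /continuous_at (_ : pospow p x = x `^ p) ?pospowE ?ltW//.
  apply: (@cvg_trans _ ((fun y => y `^ p) @ x)).
    by apply: near_eq_cvg; near=> y; rewrite pospowE// ltW//; near: y; exact: lt_nbhsr.
  have : {for x, continuous (fun y : R => y `^ p)}; last exact.
  apply: differentiable_continuous; apply/derivable1_diffP.
  by apply: derivable_powR; rewrite in_itv/= x0.
- rewrite /continuous_at (_ : pospow p x = 0 `^ p); last by rewrite /pospow max_r// ltW.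
  apply: cvg_near_cst; near=> y; rewrite /pospow max_r// ltW//; near: y.
  exact: lt_nbhsl.
- apply/left_right_continuousP; rewrite /pospow maxxx powR0 ?gt_eqF//; split.
    by apply: cvg_near_cst; near=> y; rewrite max_r// powR0// gt_eqF.
  apply: (@cvg_trans _ ((fun y => y `^ p) @ 0^'+)); last exact: powR_cvg0.
  by apply: near_eq_cvg; near=> y; rewrite max_l//.
Unshelve. all: by end_near. Qed.

End pospow.

Section beta.
Context {R : realType}.
Local Notation mu := (@lebesgue_measure R).
Implicit Types a u : R.

Let z u : R := 2 * u - 1.
Let w u : R := 4 * u * (1 - u).

(* With z = 2 u - 1, 4 u (1 - u) = 1 - z^2: this is half of the integral of
   z^a (1 - z^2)^k over [0, 1]. *)
Definition half_beta a k : R :=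
  \int[mu]_(u in `[2^-1, 1]) (pospow a (2 * u - 1) * (4 * u * (1 - u)) ^+ k).

Let cw k : continuous (fun u : R => w u ^+ k).
Proof.
move=> x; apply: (@continuous_comp _ _ _ w (fun y => y ^+ k)); last exact: exprn_continuous.
rewrite /w; apply: cvgM; first by apply: cvgM => //; exact: cvg_cst.
by apply: cvgB => //; exact: cvg_cst.
Qed.

Let cz a : 0 <= a -> continuous (fun u : R => pospow a (z u)).
Proof.
move=> a0 x; apply: (@continuous_comp _ _ _ z (pospow a)); last exact: continuous_pospow.
rewrite /z; apply: cvgB; last exact: cvg_cst.
by apply: cvgM => //; exact: cvg_cst.
Qed.

Let czw a k : 0 <= a -> continuous (fun u : R => pospow a (z u) * w u ^+ k).
Proof. by move=> a0 x; apply: cvgM; [exact: cz|exact: cw]. Qed.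

Lemma half_beta_integrable a k : 0 <= a ->
  mu.-integrable `[2^-1, 1]
    (fun u => (pospow a (2 * u - 1) * (4 * u * (1 - u)) ^+ k)%:E).
Proof.
move=> a0; apply: continuous_compact_integrable; first exact: segment_compact.
by apply: continuous_subspaceT; exact: czw.
Qed.

(** Since w' = -4 z and z^2 = 1 - w, the term z^(a+1) w' w^(k-1) splits into two integrands with the
    same exponent a. At k = 0 the factor [k%:R] removes the terms with [k.-1]. *)
Let dF a k u : 0 <= a -> 2^-1 < u ->
  is_derive u 1 (fun v => pospow (a + 1) (z v) * w v ^+ k)
   (2 * (a + 1) * (pospow a (z u) * w u ^+ k) -
    4 * k%:R * (pospow a (z u) * w u ^+ k.-1 - pospow a (z u) * w u ^+ k.-1.+1)).
Proof.
move=> a0 u2; have z0 : 0 < z u by rewrite /z; lra.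
have dz : is_derive u 1 z 2.
  rewrite /z; apply: is_derive_eq.
  by rewrite subr0 /GRing.scale/= mulr1.
have dw : is_derive u 1 w (4 - 8 * u).
  rewrite /w; apply: is_derive_eq.
  by rewrite /GRing.scale/=; ring.
have dp : is_derive (z u) 1 (pospow (a + 1)) ((a + 1) * pospow a (z u)).
  apply: (@near_eq_is_derive _ _ _ (fun y : R => y `^ (a + 1))) => //.
    by near=> y; rewrite pospowE// ltW//; near: y; exact: lt_nbhsr.
  apply: is_derive_eq; first exact: is_derive1_powR.
  by rewrite addrK pospowE// ltW.
have d1 := is_derive1_comp dp dz; have d2 := is_deriveX k dw.
have -> : (fun v => pospow (a + 1) (z v) * w v ^+ k) =
    ((pospow (a + 1) \o z) * (w ^+ k))%R :> (R -> R).
  by apply/funext => v; rewrite !fctE.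
apply: (is_derive_eq (is_deriveM d1 d2)).
rewrite /GRing.scale/= pospowE ?ltW// pospowE ?ltW// powRD; last by rewrite (gt_eqF z0) implybT.
rewrite powRr1 ?ltW// !fctE.
case: k {d2} => [|k]; first by rewrite !expr0; ring.
rewrite /= exprS; move: (z u `^ a) (w u ^+ k) => Z W.
by rewrite /z /w; ring.
Unshelve. all: by end_near. Qed.

Let half_beta_parts a k : 0 <= a ->
  2 * (a + 1) * half_beta a k -
    4 * k%:R * (half_beta a k.-1 - half_beta a k.-1.+1) = (k == 0)%:R.
Proof.
move=> a0; have l2 : 2^-1 < 1 :> R by lra.
have int (f : R -> R) : continuous f -> mu.-integrable `[2^-1, 1] (EFin \o f).
  move=> cf; apply: continuous_compact_integrable; first exact: segment_compact.
  exact: continuous_subspaceT.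
have cB (f g : R -> R) : continuous f -> continuous g -> continuous (fun x => f x - g x).
  by move=> cf cg x; apply: cvgB; [exact: cf|exact: cg].
have cZ r (f : R -> R) : continuous f -> continuous (fun x => r * f x).
  by move=> cf x; apply: cvgM; [exact: cvg_cst|exact: cf].
rewrite /half_beta -RintegralB//; try by apply: int; exact: czw.
rewrite -!RintegralZl//; last 2 first.
- by apply: int; apply: cB; exact: czw.
- by apply: int; exact: czw.
rewrite -RintegralB//; last 2 first.
- by apply: int; apply: cZ; exact: czw.
- by apply: int; apply: cZ; apply: cB; exact: czw.
rewrite /Rintegral (@continuous_FTC2 _ _ (fun v => pospow (a + 1) (z v) * w v ^+ k))//.
(* Boundary terms: w vanishes at u = 1 unless its exponent is 0, and z vanishes at u = 1/2. *)
- rewrite /= /z /w mulr1 subrr mulr0 expr0n divff// subrr.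
  rewrite (_ : 2 - 1 = 1); last by ring.
  rewrite !pospowE// powR1 mul1r powR0 ?mul0r ?subr0//.
  by rewrite gt_eqF// ltr_wpDl.
- apply: continuous_subspaceT; apply: (cB); apply: (cZ); last apply: (cB); exact: czw.
- have a1 : 0 <= a + 1 by rewrite addr_ge0.
  split.
  + by move=> x; rewrite in_itv/= => /andP[h _]; have [] := dF k a0 h.
  + by apply: cvg_at_right_filter; exact: czw.
  + by apply: cvg_at_left_filter; exact: czw.
- move=> x; rewrite in_itv/= => /andP[h _]; have [_] := dF k a0 h.
  by rewrite derive1E.
Qed.

Lemma half_beta0 a : 0 <= a -> half_beta a 0 = (2 * (a + 1))^-1.
Proof.
move=> a0; have := half_beta_parts 0 a0; rewrite mulr0 mul0r subr0 => e.
have c0 : 2 * (a + 1) != 0 by rewrite mulf_neq0// gt_eqF// ltr_wpDl.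
by apply: (mulfI c0); rewrite e divff.
Qed.

Lemma half_betaS a k : 0 <= a ->
  (a + 1 + 2 * k.+1%:R) * half_beta a k.+1 = 2 * k.+1%:R * half_beta a k.
Proof. by move=> a0; have := half_beta_parts k.+1 a0; rewrite /=; lra. Qed.

(** The value is B((a+1)/2, k+1) / 4. The recursion [half_betaS] and the functional equation of
    Gamma determine it, without the general relation between Beta and Gamma. *)
Lemma half_betaE a k : 0 <= a ->
  half_beta a k =
  4^-1 * Gamma ((a + 1) / 2) * k`!%:R / Gamma ((a + 1) / 2 + k.+1%:R).
Proof.
move=> a0; have b0 : 0 < (a + 1) / 2 by rewrite divr_gt0// ltr_wpDl.
elim: k => [|k IH].
  rewrite half_beta0// GammaS//.
  have := Gamma_gt0 b0; set g := Gamma _ => g0; rewrite fact0; field.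
  by rewrite (gt_eqF g0) gt_eqF// ltr_wpDl.
have := half_betaS k a0; rewrite IH => e.
have c0 : 0 < a + 1 + 2 * k.+1%:R :> R by rewrite addr_gt0// ltr_wpDl.
apply: (mulfI (lt0r_neq0 c0)); rewrite {}e.
have d0 : 0 < (a + 1) / 2 + k.+1%:R by rewrite addr_gt0.
rewrite -[k.+2%:R]natr1 addrA GammaS// factS natrM.
have := Gamma_gt0 d0; set g := Gamma ((a + 1) / 2 + k.+1%:R) => g0.
field; rewrite (gt_eqF g0)/=.
have -> : a + 1 + (1 + k%:R) * 2 = a + 1 + 2 * k.+1%:R by rewrite -nat1r; ring.
by rewrite gt_eqF.
Qed.
End beta.

(** * Limits of the moments with a given number of switches *)

Section limit_density.
Context {R : realType}.
Local Notation mu := (@lebesgue_measure R).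
Implicit Types p u : R.

(* The limit of [npaths m n (u m) / m ^ n.-1], read off the closed form [npathsE]
   by 'C(u m, j) ~ (u m)^j / j!. *)
Definition path_density (n : nat) u : R :=
  if odd n then
    let k := n./2 in
    u ^+ k / k`!%:R * ((1 - u) ^+ k / k`!%:R) -
    (if k is k'.+1 then u ^+ k' / k'`!%:R else 0) * ((1 - u) ^+ k.+1 / k.+1`!%:R)
  else
    let k := n./2.-1 in
    u ^+ k.+1 / k.+1`!%:R * ((1 - u) ^+ k / k`!%:R) -
    u ^+ k / k`!%:R * ((1 - u) ^+ k.+1 / k.+1`!%:R).

(** Arranged so that even n give the coefficients of the Bessel series of order p/2, and odd n the
    coefficients of orders p/2 - 1 and (p - 1)/2, shifted by one index. *)
Definition moment_coef p (n : nat) : R :=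
  let k := n./2 in
  if odd n then
    (2 * 4 ^+ k * k.+1`!%:R)^-1 *
    (Gamma (p / 2 + 1) / Gamma (p / 2 + k.+1%:R) -
     p / 2 * (Gamma ((p + 1) / 2) / Gamma ((p + 1) / 2 + k.+1%:R)))
  else Gamma (p / 2 + 1) / (4 ^+ k * k`!%:R * Gamma (p / 2 + k.+1%:R)).

Let fact_neq0 k : k`!%:R != 0 :> R.
Proof. by rewrite pnatr_eq0 -lt0n fact_gt0. Qed.

Let pospowS p u : 0 <= p -> 0 <= u -> pospow (p + 1) u = u * pospow p u.
Proof.
move=> p0 u0; rewrite !pospowE// mulrC; have [->|un0] := eqVneq u 0.
  by rewrite mulr0 powR0// gt_eqF// ltr_wpDl.
by rewrite powRD ?powRr1// un0 implybT.
Qed.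

Let hb_int (a : R) k : 0 <= a -> mu.-integrable `[2^-1, 1]
    (EFin \o (fun u : R => (pospow a (2 * u - 1) * (4 * u * (1 - u)) ^+ k))).
Proof. exact: half_beta_integrable. Qed.

Lemma integral_path_density p n : 0 <= p ->
  \int[mu]_(u in `[2^-1, 1]) (pospow p (2 * u - 1) * path_density n.+1 u) =
  moment_coef p n.+1.
Proof.
move=> p0; have [p1 h0] : 0 <= p + 1 /\ 0 < p / 2 + 1.
  by split; [rewrite addr_ge0|rewrite ltr_wpDl// divr_ge0].
have e1 : (p + 1 + 1) / 2 = p / 2 + 1 by field.
have mI : measurable (`[2^-1, 1] : set R) by [].
have iZ (c : R) (f : R -> R) : mu.-integrable `[2^-1, 1] (EFin \o f) ->
    mu.-integrable `[2^-1, 1] (EFin \o (fun u => c * f u)).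
  by move=> fi; rewrite (_ : _ \o _ = fun x => (c%:E * (f x)%:E)%E)//; exact: integrableZl.
have iB (f g : R -> R) : mu.-integrable `[2^-1, 1] (EFin \o f) ->
    mu.-integrable `[2^-1, 1] (EFin \o g) ->
    mu.-integrable `[2^-1, 1] (EFin \o (fun u => f u - g u)).
  by move=> fi gi; rewrite (_ : _ \o _ = fun x => ((f x)%:E - (g x)%:E)%E)//; exact: integrableB.
have iD (f g : R -> R) : mu.-integrable `[2^-1, 1] (EFin \o f) ->
    mu.-integrable `[2^-1, 1] (EFin \o g) ->
    mu.-integrable `[2^-1, 1] (EFin \o (fun u => f u + g u)).
  by move=> fi gi; rewrite (_ : _ \o _ = fun x => ((f x)%:E + (g x)%:E)%E)//; exact: integrableD.
have z0 u : u \in `[2^-1, 1]%classic -> 0 <= 2 * u - 1.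
  by rewrite inE/= in_itv/= => /andP[]; lra.
have [k [nE|nE]] : exists k, n.+1 = k.*2.+1 \/ n.+1 = k.*2.+2.
  exists n./2; have := odd_double_half n; case: odd => /=; lia.
- have e2 : (k.*2.+1)./2 = k by lia.
  have e3 : odd k.*2.+1 by rewrite /= odd_double.
  rewrite nE /moment_coef /path_density e2 e3.
  transitivity ((4 ^+ k * k`!%:R * k.+1`!%:R)^-1 *
      ((p + 2 + 2 * k%:R) * half_beta (p + 1) k - p * half_beta p k)); last first.
    have G1 : Gamma (p / 2 + 1 + k.+1%:R) = (p / 2 + k.+1%:R) * Gamma (p / 2 + k.+1%:R).
      by rewrite addrAC GammaS// ltr_wpDl// divr_ge0.
    rewrite !half_betaE// e1 G1.
    have gG : Gamma (p / 2 + k.+1%:R) != 0 :> R.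
      by rewrite gt_eqF// Gamma_gt0// ltr_wpDl// divr_ge0.
    have gH : Gamma ((p + 1) / 2 + k.+1%:R) != 0 :> R.
      by rewrite gt_eqF// Gamma_gt0// ltr_wpDl// divr_ge0.
    have d0 : p / 2 + k.+1%:R != 0 by rewrite gt_eqF// ltr_wpDl// divr_ge0.
    have f0 := fact_neq0 k; have f1 := fact_neq0 k.+1.
    have F0 : (4 : R) ^+ k != 0 by rewrite expf_neq0.
    have -> : p + 2 + 2 * k%:R = 2 * (p / 2 + k.+1%:R) by rewrite -nat1r; field.
    move: (p / 2 + k.+1%:R) gG d0 => e gG d0.
    by field; rewrite gG gH f0 f1 F0 d0.
  case: k {nE} e2 e3 => [|k] e2 e3.
    rewrite mulr0 addr0 !half_beta0// fact0 !expr0.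
    transitivity (half_beta p 0).
      by apply: eq_Rintegral => u _; rewrite expr0 divr1 !mulr1 mul0r subr0 mulr1.
    have q1 : p + 1 != 0 by rewrite gt_eqF// ltr_wpDl.
    have q2 : p + 1 + 1 != 0 by rewrite gt_eqF// ltr_wpDl// ltr_wpDl.
    by rewrite half_beta0// factS fact0; field; rewrite q1 q2.
  (* In z = 2u - 1 and w = 4u(1-u) = 1 - z^2 the density is, with K = k + 1, a multiple of 2K z
     w^(K-1) - 2K w^(K-1) + (2K+1) w^K. By [half_betaS] the three integrals collapse to the two on
     the left. *)
  have -> : (p + 2 + 2 * k.+1%:R) * half_beta (p + 1) k.+1 - p * half_beta p k.+1 =
      2 * k.+1%:R * half_beta (p + 1) k - 2 * k.+1%:R * half_beta p k +
      (1 + 2 * k.+1%:R) * half_beta p k.+1.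
    by have := half_betaS k p0; have := half_betaS k p1; lra.
  rewrite /half_beta -!RintegralZl//; try exact: hb_int.
  rewrite -RintegralB//; try by apply: iZ; exact: hb_int.
  rewrite -RintegralD//; last 2 first.
  - by apply: iB; apply: iZ; exact: hb_int.
  - by apply: iZ; exact: hb_int.
  rewrite -RintegralZl//; last first.
    by apply: iD; [apply: iB|]; apply: iZ; exact: hb_int.
  apply: eq_Rintegral => u /z0 u0; rewrite pospowS//.
  have f0 := fact_neq0 k; have f1 := fact_neq0 k.+1; have f2 := fact_neq0 k.+2.
  have F0 : (4 : R) ^+ k != 0 by rewrite expf_neq0.
  have d1 : (1 : R) + k%:R != 0 by rewrite nat1r pnatr_eq0.
  have d2 : (2 : R) + k%:R != 0 by rewrite -natrD pnatr_eq0.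
  rewrite !exprMn ![_ ^+ k.+2]exprS ![_ ^+ k.+1]exprS ![k.+2`!]factS ![k.+1`!]factS !natrM.
  rewrite -[k.+2%:R]nat1r -[k.+1%:R]nat1r addrA.
  move: (k`!%:R) (u ^+ k) ((1 - u) ^+ k) (pospow _ _) (4 ^+ k) f0 F0
      => f U V Z F f0 F0.
  by field; rewrite f0 d1 d2 F0.
- have e2 : (k.*2.+2)./2 = k.+1 by lia.
  have e3 : odd k.*2.+2 = false by rewrite /= odd_double.
  rewrite nE /moment_coef /path_density e2 e3 [k.+1.-1]/=.
  (* The two products differ by the factor u - (1 - u) = 2u - 1, which raises the exponent p to p +
     1. *)
  transitivity ((4 ^+ k * k`!%:R * k.+1`!%:R)^-1 * half_beta (p + 1) k).
    rewrite /half_beta -RintegralZl//; last exact: hb_int.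
    apply: eq_Rintegral => u /z0 u0; rewrite pospowS//.
    have f0 := fact_neq0 k; have f1 := fact_neq0 k.+1.
    have F0 : (4 : R) ^+ k != 0 by rewrite expf_neq0.
    rewrite !exprMn !exprS.
    move: (k`!%:R) (k.+1`!%:R) (u ^+ k) ((1 - u) ^+ k) (pospow _ _) (4 ^+ k) f0 f1 F0
      => f f' U V Z F f0 f1 F0.
    by field; rewrite f0 f1 F0.
  rewrite half_betaE// e1 exprS.
  have -> : p / 2 + 1 + k.+1%:R = p / 2 + k.+2%:R by rewrite -[k.+2%:R]nat1r addrA.
  have gG : Gamma (p / 2 + k.+2%:R) != 0 :> R.
    by rewrite gt_eqF// Gamma_gt0// ltr_wpDl// divr_ge0.
  have f0 := fact_neq0 k; have f1 := fact_neq0 k.+1.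
  have F0 : (4 : R) ^+ k != 0 by rewrite expf_neq0.
  by field; rewrite gG f0 f1 F0.
Qed.

Lemma cvg_bin_ratio (x : nat -> nat) (xi : R) k :
  (x m)%:R / m.+1%:R @[m --> \oo] --> xi ->
  'C(x m, k)%:R / m.+1%:R ^+ k @[m --> \oo] --> xi ^+ k / k`!%:R.
Proof.
move=> xxi; elim: k => [|k IH].
  by under eq_fun do rewrite bin0 expr0 divr1; rewrite expr0 fact0 divr1; exact: cvg_cst.
have inv0 : k%:R / m.+1%:R @[m --> \oo] --> (0 : R).
  by rewrite -[X in _ --> X](mulr0 (k%:R : R)); apply: cvgM; [exact: cvg_cst|exact: cvg_harmonic].
rewrite (_ : (fun m => _) = fun m => 'C(x m, k)%:R / m.+1%:R ^+ k *
   ((x m)%:R / m.+1%:R - k%:R / m.+1%:R) / k.+1%:R :> R); last first.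
  apply/funext => m.
  have : ('C(x m, k.+1) * k.+1)%:R = 'C(x m, k)%:R * ((x m)%:R - k%:R) :> R.
    have [kx|xk] := leqP k (x m).
      by rewrite -natrB// -natrM mulnC mul_bin_left mulnC.
    by rewrite !bin_small ?mul0n ?mul0r// ltnW.
  rewrite natrM => e.
  have -> : 'C(x m, k.+1)%:R = 'C(x m, k)%:R * ((x m)%:R - k%:R) / k.+1%:R :> R.
    by rewrite -e mulfK.
  rewrite exprS.
  by field; rewrite expf_neq0 ?nat1r ?pnatr_eq0.
have -> : xi ^+ k.+1 / k.+1`!%:R = xi ^+ k / k`!%:R * (xi - 0) / k.+1%:R.
  rewrite factS natrM exprS; have := fact_neq0 k; move: (k`!%:R) => f f0.
  by field; rewrite f0 nat1r pnatr_eq0.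
by apply: cvgM; last exact: cvg_cst; apply: cvgM => //; apply: cvgB.
Qed.

Lemma cvg_ratio_bounded (x : nat -> nat) (xi C : R) :
  (forall m, `|(x m)%:R - xi * m.+1%:R| <= C) ->
  (x m)%:R / m.+1%:R @[m --> \oo] --> xi.
Proof.
move=> h; apply/cvgrPdist_le => e e0.
have : C / m.+1%:R @[m --> \oo] --> (0 : R).
  by rewrite -[X in _ --> X](mulr0 C); apply: cvgM; [exact: cvg_cst|exact: cvg_harmonic].
move=> /cvgrPdist_le /(_ _ e0); apply: filterS => m.
rewrite sub0r normrN; apply: le_trans.
have -> : xi - (x m)%:R / m.+1%:R = - ((x m)%:R - xi * m.+1%:R) / m.+1%:R.
  by field; rewrite nat1r pnatr_eq0.
by rewrite !normrM normrN ler_wpM2r// (le_trans (h m))// ler_norm.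
Qed.

End limit_density.

(** * Riemann sums as integrals of step functions *)

Section riemann.
Context {R : realType}.
Local Notation mu := (@lebesgue_measure R).
Implicit Types p u : R.

(** Its integral over [0, 1) is a Riemann sum, so that the limit can be taken by dominated
    convergence from pointwise asymptotics alone. *)
Definition step_fun (g : nat -> R) (m : nat) (u : R) : R :=
  \sum_(U < m.+1) g U * \1_`[U%:R / m.+1%:R, U.+1%:R / m.+1%:R[ u.

Lemma step_funE g m u : 0 <= u < 1 ->
  step_fun g m u = g (Num.truncn (u * m.+1%:R)).
Proof.
move=> /andP[u0 u1]; have um0 : 0 <= u * m.+1%:R by rewrite mulr_ge0.
have [t1 t2] := andP (truncn_itv um0).
have tm : (Num.truncn (u * m.+1%:R) < m.+1)%N.
  by rewrite -(ltr_nat R) (le_lt_trans t1)// gtr_pMl.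
rewrite /step_fun (bigD1 (Ordinal tm))//= big1 ?addr0.
  rewrite indicE mem_set ?mulr1//= in_itv/=.
  by rewrite ler_pdivrMr// t1 ltr_pdivlMr.
move=> i it; rewrite indicE memNset ?mulr0//= in_itv/=.
rewrite ler_pdivrMr// ltr_pdivlMr// => /andP[i1 i2].
by move/negP: it; apply; apply/eqP/val_inj => /=; apply/esym/truncn_def; rewrite i1.
Qed.

Lemma measurable_step_fun g m D : measurable_fun D (step_fun g m).
Proof.
apply: measurable_funTS; apply: measurable_sum => i.
by apply: measurable_funM => //; exact: measurable_indic.
Qed.

Lemma integral_step_fun g m : (forall U, 0 <= g U) ->
  (\int[mu]_(u in `[0%R, 1%R[) (step_fun g m u)%:E =
   (\sum_(U < m.+1) g U / m.+1%:R)%:E)%E.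
Proof.
move=> g0; under eq_integral do rewrite /step_fun -sumEFin.
rewrite ge0_integral_sum//=; last 2 first.
- move=> i; apply: measurableT_comp => //.
  by apply: measurable_funTS; apply: measurable_funM => //; exact: measurable_indic.
- by move=> i x _; rewrite lee_fin mulr_ge0// indicE.
rewrite -sumEFin; apply: eq_bigr => i _.
under eq_integral do rewrite EFinM.
rewrite ge0_integralZl//=; last 2 first.
- by apply: measurableT_comp => //; apply: measurable_funTS; exact: measurable_indic.
- by rewrite lee_fin.
rewrite integral_indic// setIidl; last first.
  move=> x /=; rewrite !in_itv/= => /andP[x1 x2]; apply/andP; split.
    by apply: le_trans x1; rewrite divr_ge0.
  by apply: lt_le_trans x2 _; rewrite ler_pdivrMr// mul1r ler_nat ltn_ord.
pose I : set R := `[i%:R / m.+1%:R, i.+1%:R / m.+1%:R[%classic.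
transitivity ((g i)%:E * lebesgue_measure I)%E => //.
rewrite /I lebesgue_measure_itv/= lte_fin ltr_pM2r ?invr_gt0// ltr_nat ltnSn.
by rewrite -EFinB -mulrBl -natrB// subSnn mul1r EFinM.
Qed.

End riemann.

Section scaled_moment.
Context {R : realType}.
Local Notation mu := (@lebesgue_measure R).
Implicit Types p u : R.

(** The argument of [pospow] is the end point divided by the number of steps; dividing by
    [m.+1 ^+ n] compensates the growth of the number of words with n switches. *)
Definition scaled_moment p (n m : nat) : R :=
  \sum_(U < m.+2) pospow p (2 * (U%:R / m.+1%:R) - 1) * ((npaths m n U)%:R / m.+1%:R ^+ n).

Lemma scaled_moment_ge0 p n m : 0 <= scaled_moment p n m.
Proof. by apply: sumr_ge0 => i _; rewrite mulr_ge0 ?pospow_ge0. Qed.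

Lemma sum_npaths_le m n : (\sum_(U < m.+2) npaths m n U <= 'C(m, n))%N.
Proof.
rewrite /npaths exchange_big -npaths_total; apply: leq_sum => s _.
case: (flips s == n); last by rewrite big1.
have [h|h] := leqP m.+2 (ups s).
  by rewrite big1// => i _; case: eqP => // e; have := ltn_ord i; rewrite -e ltnNge h.
rewrite (bigD1 (Ordinal h))//= eqxx/= big1 ?addn0 ?leq_b1// => i ih.
by case: eqP => // e; move/negP: ih; case; apply/eqP/val_inj.
Qed.

Lemma ffact_le_exp n m M : (m <= M)%N -> (m ^_ n <= M ^ n)%N.
Proof.
elim: n m => // n IH m mM; rewrite ffactnS expnS leq_mul// IH//.
exact: leq_trans (leq_pred m) mM.
Qed.

Lemma bin_le_exp k m M : (m <= M)%N -> ('C(m, k) <= M ^ k)%N.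
Proof.
move=> mM; apply: leq_trans (ffact_le_exp k mM).
by rewrite -bin_ffact leq_pmulr// fact_gt0.
Qed.

(** The payoff is at most 1 and at most 'C(m, n) words have n switches. Being uniform in m, the
    bound supplies the exponential series that dominates in [tannery]. *)
Lemma scaled_moment_le p n m : 0 <= p -> scaled_moment p n m <= n`!%:R^-1.
Proof.
move=> p0; have M0 : 0 < m.+1%:R :> R by [].
apply: (@le_trans _ _ (\sum_(U < m.+2) (npaths m n U)%:R / m.+1%:R ^+ n)).
  apply: ler_sum => i _; rewrite ler_piMl//; apply: pospow_le1 => //.
  have : i%:R / m.+1%:R <= 1 :> R.
    by rewrite ler_pdivrMr// mul1r ler_nat -ltnS ltn_ord.
  by move: (_ / _) => r; lra.
rewrite -mulr_suml -natr_sum ler_pdivrMr ?exprn_gt0//.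
apply: (@le_trans _ _ 'C(m, n)%:R); first by rewrite ler_nat sum_npaths_le.
rewrite mulrC ler_pdivlMr ?ltr0n ?fact_gt0// -natrM bin_ffact -natrX ler_nat.
exact: ffact_le_exp.
Qed.

Lemma scaled_moment_small p n m : (m < n)%N -> scaled_moment p n m = 0.
Proof.
move=> mn; have := sum_npaths_le m n; rewrite bin_small// leqn0 sum_nat_eq0 => /forallP h.
by rewrite /scaled_moment big1// => i _; rewrite (eqP (h i)) mul0r mulr0.
Qed.

Lemma scaled_moment0 p m : scaled_moment p 0 m = 1.
Proof.
rewrite /scaled_moment big_ord_recr/= npaths_noflip eqxx big1 ?add0r.
  by rewrite divff// mulr1 expr0 divr1 mulr1 pospowE; [rewrite (_ : 2 - 1 = 1) ?powR1//; ring|lra].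
by move=> i _; rewrite npaths_noflip (ltn_eqF (ltn_ord i)) mul0r mulr0.
Qed.

(** Fixing the end point removes one degree of freedom, hence exponent n for n + 1 switches. This
    makes the constant 1 a dominating function for the step functions. *)
Lemma npaths_le_exp m n U : (npaths m n.+1 U <= m.+1 ^ n)%N.
Proof.
have [h|h] := leqP m.+1 U.*2; last by rewrite npaths_low.
have [hm|hm] := ltnP m U; first by rewrite npaths_high.
case: U h hm => // a h hm.
have [k nE] : exists k, n = k.*2 \/ n = k.*2.+1.
  by exists n./2; have := odd_double_half n; case: odd => /=; lia.
have [E1 E2] := @npathsE a (m - a.+1) k ltac:(lia).
rewrite (_ : (a + (m - a.+1)).+1 = m) in E1 E2; last by lia.
have la : (a <= m.+1)%N by lia.
have lb : (m - a.+1 <= m.+1)%N by lia.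
case: nE => ->.
  apply: (@leq_trans ('C(a, k) * 'C(m - a.+1, k))); first by rewrite -E1 leq_addr.
  by rewrite -addnn expnD leq_mul ?bin_le_exp.
apply: (@leq_trans ('C(a, k.+1) * 'C(m - a.+1, k))); first by rewrite -E2 leq_addr.
by rewrite -addnn -addSn expnD leq_mul ?bin_le_exp.
Qed.

(** One power of [m.+1] fewer than in [scaled_moment]: the missing factor is the mesh of the Riemann
    sum. *)
Let step_height p n m (U : nat) : R :=
  pospow p (2 * (U%:R / m.+1%:R) - 1) * ((npaths m n.+1 U)%:R / m.+1%:R ^+ n).

Lemma scaled_momentS p n m : (scaled_moment p n.+1 m)%:E =
  (\int[mu]_(u in `[0%R, 1%R[) (step_fun (step_height p n m) m u)%:E)%E.
Proof.
rewrite integral_step_fun; last first.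
  by move=> U; rewrite mulr_ge0 ?pospow_ge0.
congr EFin; rewrite /scaled_moment big_ord_recr/= npaths_high// mul0r mulr0 addr0.
by apply: eq_bigr => i _; rewrite /step_height exprSr invfM !mulrA.
Qed.

Let cvg_step p n u : 0 <= p -> 2^-1 < u < 1 ->
  step_height p n m (Num.truncn (u * m.+1%:R)) @[m --> \oo] -->
  pospow p (2 * u - 1) * path_density n.+1 u.
Proof.
move=> p0 /andP[u2 u1].
pose U m := Num.truncn (u * m.+1%:R).
have U1 m : (U m)%:R <= u * m.+1%:R < (U m)%:R + 1.
  by rewrite natr1 truncn_itv// mulr_ge0//; lra.
have Um m : (U m <= m)%N.
  have /andP[h _] := U1 m; rewrite -ltnS -(ltr_nat R) (le_lt_trans h)// gtr_pMl//.
have cU : (U m)%:R / m.+1%:R @[m --> \oo] --> u.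
  apply: (@cvg_ratio_bounded _ _ _ 1) => m; rewrite ler_norml.
  by have := U1 m; move: (u * _) => v; lra.
have cA : (U m).-1%:R / m.+1%:R @[m --> \oo] --> u.
  apply: (@cvg_ratio_bounded _ _ _ 2) => m; rewrite ler_norml.
  have := U1 m; have : (U m).-1%:R <= ((U m)%:R : R) <= (U m).-1%:R + 1.
    by rewrite natr1 !ler_nat; lia.
  by move: (u * _) => v; lra.
have cB : (m - U m)%:R / m.+1%:R @[m --> \oo] --> 1 - u.
  apply: (@cvg_ratio_bounded _ _ _ 1) => m; rewrite ler_norml.
  rewrite mulrBl mul1r natrB//; have := U1 m; rewrite -[m.+1%:R]nat1r.
  by move: (u * _) => v; lra.
(* The closed form [npathsE] needs [b <= a], that is, an end point at or above 0; as u > 1/2 this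
   holds for large m. *)
have big : \forall m \near \oo, (m.+1 <= (U m).*2)%N /\ (0 < U m)%N.
  have c0 : 0 < 2 * u - 1 by lra.
  near=> m.
  have hm : 2 <= (2 * u - 1) * m.+1%:R.
    rewrite -ler_pdivrMl//; near: m; exists (Num.truncn ((2 * u - 1)^-1 * 2)).+1 => // m /= hm.
    by rewrite ltW// (lt_le_trans (truncnS_gt _))// ler_nat (leq_trans hm).
  have hU : (m.+1)%:R <= (U m).*2%:R :> R.
    rewrite -muln2 natrM; have := U1 m; move: hm; rewrite mulrBl mul1r -mulrA.
    by move: (u * _) => v; lra.
  by move: hU; rewrite ler_nat; lia.
rewrite (_ : (fun m => _) = (fun m => pospow p (2 * ((U m)%:R / m.+1%:R) - 1) *
   ((npaths m n.+1 (U m))%:R / m.+1%:R ^+ n)))//.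
apply: cvgM.
  apply: (@cvg_comp _ _ _ (fun m => 2 * ((U m)%:R / m.+1%:R) - 1 : R) (pospow p)); last first.
    exact: continuous_pospow.
  by apply: cvgB; [apply: cvgM => //|]; exact: cvg_cst.
have M0 m : (m.+1%:R : R) != 0 by rewrite pnatr_eq0.
have [k nE] : exists k, n = k.*2 \/ n = k.*2.+1.
  by exists n./2; have := odd_double_half n; case: odd => /=; lia.
case: nE => ->.
- rewrite /path_density [odd _]/= odd_double; rewrite (_ : k.*2.+1./2 = k); last by lia.
  rewrite [~~ _]/=.
  pose X m : R := if k is k'.+1 then 'C((U m).-1, k')%:R / m.+1%:R ^+ k' else 0.
  apply: (@cvg_trans _ ((fun m => 'C((U m).-1, k)%:R / m.+1%:R ^+ k *
      ('C(m - U m, k)%:R / m.+1%:R ^+ k) - X m * ('C(m - U m, k.+1)%:R / m.+1%:R ^+ k.+1) : R) @ \oo)).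
    apply: near_eq_cvg; near=> m.
    have [h1 h2] : (m.+1 <= (U m).*2)%N /\ (0 < U m)%N by near: m.
    have [E1 _] := @npathsE (U m).-1 (m - U m) k ltac:(lia).
    rewrite prednK// (_ : ((U m).-1 + (m - U m)).+1 = m) in E1; last by have := Um m; lia.
    have -> : (npaths m k.*2.+1 (U m))%:R = 'C((U m).-1, k)%:R * 'C(m - U m, k)%:R -
       (if k is k'.+1 then 'C((U m).-1, k') else 0)%:R * 'C(m - U m, k.+1)%:R :> R.
      by rewrite -!natrM -E1 natrD addrK.
    rewrite /X -addnn exprD; case: (k) => [|k']; rewrite ?expr0 ?exprS; field;
      by rewrite ?expf_neq0 ?nat1r ?M0.
  apply: cvgB; apply: cvgM; try exact: cvg_bin_ratio.
  rewrite /X; case: (k) => [|k']; [exact: cvg_cst|exact: cvg_bin_ratio].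
- rewrite /path_density [odd _]/= odd_double; rewrite (_ : k.*2.+2./2 = k.+1); last by lia.
  rewrite [~~ _]/= [k.+1.-1]/=.
  apply: (@cvg_trans _ ((fun m => 'C((U m).-1, k.+1)%:R / m.+1%:R ^+ k.+1 *
      ('C(m - U m, k)%:R / m.+1%:R ^+ k) -
      'C((U m).-1, k)%:R / m.+1%:R ^+ k * ('C(m - U m, k.+1)%:R / m.+1%:R ^+ k.+1) : R) @ \oo)).
    apply: near_eq_cvg; near=> m.
    have [h1 h2] : (m.+1 <= (U m).*2)%N /\ (0 < U m)%N by near: m.
    have [_ E1] := @npathsE (U m).-1 (m - U m) k ltac:(lia).
    rewrite prednK// (_ : ((U m).-1 + (m - U m)).+1 = m) in E1; last by have := Um m; lia.
    have -> : (npaths m k.*2.+2 (U m))%:R = 'C((U m).-1, k.+1)%:R * 'C(m - U m, k)%:R -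
       'C((U m).-1, k)%:R * 'C(m - U m, k.+1)%:R :> R.
      by rewrite -!natrM -E1 natrD addrK.
    rewrite -addnn !exprS exprD; field; by rewrite ?expf_neq0 ?nat1r ?M0.
  by apply: cvgB; apply: cvgM; exact: cvg_bin_ratio.
Unshelve. all: by end_near. Qed.

Let step_height01 p n m (U : nat) : 0 <= p -> (U <= m)%N ->
  0 <= step_height p n m U <= 1.
Proof.
move=> p0 Um; rewrite /step_height mulr_ge0 ?pospow_ge0 ?divr_ge0 ?exprn_ge0//=.
rewrite -[leRHS]mul1r ler_pM ?pospow_ge0 ?divr_ge0 ?exprn_ge0//.
  apply: pospow_le1 => //; have : U%:R / m.+1%:R <= 1 :> R.
    by rewrite ler_pdivrMr// mul1r ler_nat leqW.
  by move: (_ / _) => r; lra.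
by rewrite ler_pdivrMr ?exprn_gt0// mul1r -natrX ler_nat npaths_le_exp.
Qed.

Lemma continuous_path_density n : continuous (@path_density R n).
Proof.
have cX k : continuous (fun u : R => u ^+ k / k`!%:R).
  by move=> u; apply: cvgM; [exact: exprn_continuous|exact: cvg_cst].
have cX' k : continuous (fun u : R => (1 - u) ^+ k / k`!%:R).
  move=> u; apply: (@continuous_comp _ _ _ (fun u => 1 - u) (fun y => y ^+ k / k`!%:R)); last exact: cX.
  by apply: cvgB => //; exact: cvg_cst.
rewrite /path_density; case: odd => u; apply: cvgB; apply: cvgM;
  try exact: cX; try exact: cX'.
by case: n./2 => [|k]; [exact: cvg_cst|exact: cX].
Qed.

Lemma cvg_scaled_moment p n : 0 <= p ->
  scaled_moment p n m @[m --> \oo] --> moment_coef p n.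
Proof.
move=> p0; case: n => [|n].
  rewrite /moment_coef /= expr0 fact0 !mul1r divff; last first.
    by rewrite gt_eqF// Gamma_gt0// ltr_wpDl// divr_ge0.
  by under eq_fun do rewrite scaled_moment0; exact: cvg_cst.
rewrite -integral_path_density//.
(* Left of 1/2 the counts vanish by [npaths_low], right of it [cvg_step] applies. The point 1/2 is
   covered by neither and is removed as a null set. *)
pose D : set R := `[0, 1[%classic `\ 2^-1.
pose f (u : R) := (pospow p (2 * u - 1) * path_density n.+1 u)%:E.
have mD : measurable D by exact: measurableD.
have DE u : D u -> 0 <= u < 1 by move=> [+ _]; rewrite /= in_itv.
have DI : D `&` `]2^-1, 1[%classic = `]2^-1, 1[%classic.
  apply/seteqP; split => u /=; first by case.
  rewrite /D /= !in_itv/= => /andP[u2 u1]; split; last by rewrite u2.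
  by split; [apply/andP; split => //; lra | move=> e; rewrite e ltxx in u2].
have := @dominated_cvg _ _ _ mu D mD
  (fun m u => (step_fun (step_height p n m) m u)%:E) (f \_ `]2^-1, 1[%classic) (cst 1%E).
have step u m : 0 <= u < 1 -> step_fun (step_height p n m) m u =
    step_height p n m (Num.truncn (u * m.+1%:R)) by move=> ?; rewrite step_funE.
have trunc_le u m : 0 <= u < 1 -> (Num.truncn (u * m.+1%:R) <= m)%N.
  move=> /andP[u0 u1]; rewrite -ltnS -(ltr_nat R).
  by rewrite (@le_lt_trans _ _ (u * m.+1%:R))// ?truncn_le ?mulr_ge0// gtr_pMl.
move=> /(_ _ _ _ _ _); rewrite -integral_mkcondr DI => H.
have cf : continuous (fun u : R => pospow p (2 * u - 1) * path_density n.+1 u).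
  move=> u; apply: cvgM; last exact: continuous_path_density.
  apply: (@continuous_comp _ _ _ (fun u => 2 * u - 1) (pospow p)); last exact: continuous_pospow.
  by apply: cvgB; [apply: cvgM => //|]; exact: cvg_cst.
have mf : measurable_fun (`]2^-1, 1[%classic : set R) f.
  apply: measurableT_comp => //; apply: measurable_funTS.
  exact: continuous_measurable_fun.
have ffin : (\int[mu]_(u in `]2^-1%R, 1%R[) f u)%E \is a fin_num.
  rewrite -(integral_itv_bndoo true false mf); apply: integrable_fin_num => //.
  apply: continuous_compact_integrable; first exact: segment_compact.
  exact: continuous_subspaceT.
rewrite /Rintegral integral_itv_bndoo//.
have : (scaled_moment p n.+1 m)%:E @[m --> \oo] --> (\int[mu]_(u in `]2^-1%R, 1%R[) f u)%E.
  have mstep m : measurable_fun D (fun u => (step_fun (step_height p n m) m u)%:E).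
    by apply: measurableT_comp => //; exact: measurable_step_fun.
  under eq_fun do rewrite scaled_momentS -(@integral_setD1 _ _ 2^-1)//.
  apply: H => //.
  - move=> u Du; have u01 := DE _ Du.
    rewrite (_ : (fun m => _) = fun m =>
        (step_height p n m (Num.truncn (u * m.+1%:R)))%:E); last first.
      by apply/funext => m; rewrite /= step.
    rewrite patchE; case: ifPn => hu.
      apply: cvg_EFin; first exact: nearW.
      by apply: cvg_step => //; move: hu; rewrite inE/= in_itv.
    apply: cvg_near_cst; apply: nearW => m; rewrite /step_height npaths_low ?mul0r ?mulr0//.
    have u2 : u < 2^-1.
      move: hu; rewrite notin_setE /= in_itv/= => /negP; rewrite negb_and -!leNgt.
      move/orP => [|]; last by case/andP: u01; lra.
      by rewrite le_eqVlt => /orP[/eqP e|//]; case: Du => _; rewrite /= e.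
    rewrite -(ltr_nat R) -muln2 natrM.
    have : (Num.truncn (u * m.+1%:R))%:R <= u * m.+1%:R.
      by rewrite truncn_le mulr_ge0//; case/andP: u01.
    have : u * m.+1%:R < 2^-1 * m.+1%:R by rewrite ltr_pM2r.
    by move: (u * _) => v; lra.
  - rewrite (_ : cst 1%E = EFin \o cst 1)//.
    have i01 : mu.-integrable `[0, 1] (EFin \o (cst 1 : R -> R)).
      apply: continuous_compact_integrable; first exact: segment_compact.
      by apply: continuous_subspaceT => x; exact: cvg_cst.
    apply: (integrableS _ _ _ i01) => //.
    by move=> u /DE; rewrite /= in_itv/= => /andP[-> /ltW ->].
  - move=> m u Du; have u01 := DE _ Du; rewrite step// abse_EFin lee_fin ger0_norm.
      by have /andP[] := step_height01 n p0 (trunc_le u m u01).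
    by have /andP[] := step_height01 n p0 (trunc_le u m u01).
by rewrite -(fineK ffin) => /fine_cvg.
Qed.

End scaled_moment.

(** * Summation over the number of switches *)

Section tannery.
Context {R : realType}.

Lemma tannery (u : nat -> nat -> R) (v b : nat -> R) (L : nat -> nat) :
  (forall n, u i n @[i --> \oo] --> v n) ->
  (forall i n, `|u i n| <= b n) -> cvgn (series b) ->
  (forall i n, (L i <= n)%N -> u i n = 0) ->
  cvgn (series v) /\ \sum_(n < L i) u i n @[i --> \oo] --> limn (series v).
Proof.
move=> uv ub cb uL.
have vb n : `|v n| <= b n.
  by apply: (cvgr_to_le (cvg_norm (uv n))); apply: nearW => i; exact: ub.
have b0 n : 0 <= b n by rewrite (le_trans _ (vb n)).
have cv : cvgn (series v).
  by apply: normed_cvg; apply: series_le_cvg cb => // n /=.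
split=> //.
have tail K n : (K <= n)%N -> \sum_(K <= j < n) b j <= limn (series b) - series b K.
  move=> Kn; rewrite -(sub_series_geq _ Kn) lerB//.
  by apply: nondecreasing_cvgn_le => //; exact: nondecreasing_series.
apply/cvgrPdist_le => e e0.
have [K hK] : exists K, limn (series b) - series b K <= e / 4.
  have /cvgrPdist_le /(_ (e / 4)) : series b @ \oo --> limn (series b) by [].
  rewrite divr_gt0// => /(_ isT) [K _ /(_ K (leqnn K)) h].
  by exists K; rewrite (le_trans (ler_norm _)).
have head : \sum_(0 <= j < K) `|u i j - v j| @[i --> \oo] --> (0 : R).
  elim: (K) => [|k IH]; first by under eq_fun do rewrite big_nil; exact: cvg_cst.
  under eq_fun do rewrite big_nat_recr//=.
  have h : `|u i k - v k| @[i --> \oo] --> (0 : R).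
    have : `|u i k - v k| @[i --> \oo] --> `|v k - v k|.
      by apply: cvg_norm; apply: cvgB => //; exact: cvg_cst.
    by rewrite subrr normr0.
  by have := cvgD IH h; rewrite addr0; exact.
have := head => /cvgrPdist_le /(_ (e / 2)); rewrite divr_gt0// => /(_ isT).
apply: filterS => i; rewrite sub0r normrN ger0_norm ?sumr_ge0// => hi.
rewrite distrC.
have cd : (fun n => `|\sum_(n < L i) u i n - series v n|) @ \oo -->
    `|\sum_(n < L i) u i n - limn (series v)|.
  by apply: cvg_norm; apply: cvgB => //; exact: cvg_cst.
apply: (cvgr_to_le cd); exists (maxn K (L i)) => // n /=; rewrite geq_max => /andP[Kn Ln].
have -> : \sum_(j < L i) u i j = \sum_(0 <= j < n) u i j.
  have z : \sum_(L i <= j < n) u i j = 0.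
    by rewrite big_nat big1// => j /andP[h _]; exact: uL.
  by rewrite (big_cat_nat (leq0n (L i)) Ln)//= z addr0 big_mkord.
rewrite /series/= -sumrB (le_trans (ler_norm_sum _ _ _))// (big_cat_nat (leq0n K) Kn)//=.
(* Below K the finitely many differences sum to at most e/2; beyond K each is at most [2 * b j], and
   the tail of b is at most e/4. *)
have -> : e = e / 2 + 2 * (e / 4) by field.
rewrite lerD// (@le_trans _ _ (\sum_(K <= j < n) 2 * b j))//.
  apply: ler_sum => j _; rewrite mulr_natl mulr2n.
  by rewrite (le_trans (ler_normB _ _))// lerD.
by rewrite -mulr_sumr ler_wpM2l// (le_trans (tail _ _ Kn)).
Qed.

End tannery.

Section walk_sum.
Context {R : realType}.
Implicit Types p y rho : R.

(** The weight y stands for lambda h and the step length rho for c h. They are independent of m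
    because the upper bound uses longer walks with the same mesh. *)
Definition walk_sum p (m : nat) y rho : R :=
  \sum_(s <- bits m) y ^+ flips s *
     (pospow p (rho * (2 * (ups s)%:R - m.+1%:R)) * (above 0 s)%:R).

Lemma sum_bits_flips_ups m (F : nat -> nat -> R) :
  \sum_(s <- bits m) F (flips s) (ups s) * (above 0 s)%:R =
  \sum_(n < m.+1) \sum_(U < m.+2) F n U * (npaths m n U)%:R.
Proof.
under [RHS]eq_bigr do under eq_bigr do rewrite /npaths natr_sum mulr_sumr.
under [RHS]eq_bigr do rewrite exchange_big/=.
rewrite exchange_big/= !big_seq; apply: eq_bigr => s; rewrite mem_bits => /eqP sm.
have h1 : (flips s < m.+1)%N by rewrite ltnS -sm count_size.
have h2 : (ups s < m.+2)%N by rewrite ltnS -sm ups_le.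
rewrite (bigD1 (Ordinal h1))//= [X in _ + X]big1 ?addr0; last first.
  move=> i ih; rewrite big1// => j _; case: eqP => [e|_]; last by rewrite mulr0.
  by move/negP: ih; case; apply/eqP/val_inj.
rewrite (bigD1 (Ordinal h2))//= [X in _ + X]big1 ?addr0; last first.
  move=> i ih; rewrite eqxx; case: eqP => [e|_]; last by rewrite mulr0.
  by move/negP: ih; case; apply/eqP/val_inj.
by rewrite !eqxx.
Qed.

Lemma walk_sumE p m y rho : 0 <= rho -> walk_sum p m y rho =
  (rho * m.+1%:R) `^ p * \sum_(n < m.+1) (y * m.+1%:R) ^+ n * scaled_moment p n m.
Proof.
move=> r0; rewrite /walk_sum; under eq_bigr do rewrite mulrA.
rewrite (sum_bits_flips_ups m (fun n U => y ^+ n * pospow p (rho * (2 * U%:R - m.+1%:R)))).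
rewrite mulr_sumr; apply: eq_bigr => n _; rewrite mulrA /scaled_moment mulr_sumr.
apply: eq_bigr => U _.
have M0 : m.+1%:R != 0 :> R by rewrite pnatr_eq0.
have -> : rho * (2 * U%:R - m.+1%:R) = (rho * m.+1%:R) * (2 * (U%:R / m.+1%:R) - 1).
  by field; rewrite nat1r.
rewrite pospowM ?mulr_ge0// exprMn; field.
by rewrite expf_neq0// nat1r.
Qed.

Definition meander_series p x : R := limn (series (fun n => x ^+ n * moment_coef p n)).

Lemma cvg_walk_sum p (m : nat -> nat) (y rho : nat -> R) (Y r Z : R) :
  0 <= p -> m i @[i --> \oo] --> \oo ->
  (forall i, 0 <= y i) -> (forall i, 0 <= rho i) ->
  (forall i, y i * (m i).+1%:R <= Z) ->
  y i * (m i).+1%:R @[i --> \oo] --> Y -> rho i * (m i).+1%:R @[i --> \oo] --> r ->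
  walk_sum p (m i) (y i) (rho i) @[i --> \oo] --> pospow p r * meander_series p Y.
Proof.
move=> p0 moo y0 rho0 yZ cY cr.
have yM i : 0 <= y i * (m i).+1%:R by rewrite mulr_ge0.
have Z0 : 0 <= Z := le_trans (yM 0%N) (yZ 0%N).
rewrite (_ : (fun i => _) = fun i => pospow p (rho i * (m i).+1%:R) *
   \sum_(n < (m i).+1) (y i * (m i).+1%:R) ^+ n * scaled_moment p n (m i)); last first.
  by apply/funext => i; rewrite walk_sumE// pospowE// mulr_ge0.
apply: cvgM.
  by apply: (@cvg_comp _ _ _ _ (pospow p) _ _ _ cr); exact: continuous_pospow.
have [] // := @tannery R (fun i n => (y i * (m i).+1%:R) ^+ n * scaled_moment p n (m i))
  (fun n => Y ^+ n * moment_coef p n) (exp_coeff Z) (fun i => (m i).+1).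
- move=> n; apply: cvgM.
    by apply: (@cvg_comp _ _ _ _ (fun x => x ^+ n) _ _ _ cY); exact: exprn_continuous.
  by apply: (@cvg_comp _ _ _ m (scaled_moment p n) _ _ _ moo); exact: cvg_scaled_moment.
- move=> i n; rewrite ger0_norm; last by rewrite mulr_ge0 ?exprn_ge0 ?scaled_moment_ge0.
  rewrite /exp_coeff/= ler_pM ?exprn_ge0 ?scaled_moment_ge0 ?scaled_moment_le//.
  by rewrite lerXn2r ?nnegrE.
- exact: is_cvg_series_exp_coeff.
- by move=> i n h; rewrite scaled_moment_small ?mulr0.
Qed.

Lemma is_cvg_meander_series p x : 0 <= p -> 0 <= x ->
  cvgn (series (fun n => x ^+ n * moment_coef p n)).
Proof.
move=> p0 x0.
have [] // := @tannery R (fun i n => x ^+ n * scaled_moment p n i)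
  (fun n => x ^+ n * moment_coef p n) (exp_coeff x) succn.
- by move=> n; apply: cvgM; [exact: cvg_cst|exact: cvg_scaled_moment].
- move=> i n; rewrite ger0_norm; last by rewrite mulr_ge0 ?exprn_ge0 ?scaled_moment_ge0.
  by rewrite /exp_coeff/= ler_pM ?exprn_ge0 ?scaled_moment_ge0 ?scaled_moment_le.
- exact: is_cvg_series_exp_coeff.
- by move=> i n h; rewrite scaled_moment_small ?mulr0.
Qed.

End walk_sum.

(** * Identification with Bessel functions *)

Section bessel.
Context {R : realType}.
Implicit Types nu x p : R.

(** From k = 1 on the argument is at least 1, where Gamma(a + 1) = a Gamma(a) >= Gamma(a). At k = 0
    it may be smaller, so the minimum of the first two values is taken. *)
Lemma Gamma_lower_bound nu : -1 < nu ->
  exists2 c : R, 0 < c & forall k, c <= Gamma (nu + k%:R + 1).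
Proof.
move=> nu1; have g k : 0 < Gamma (nu + k%:R + 1).
  by apply: Gamma_gt0; rewrite addrAC ltr_pwDl//; lra.
exists (Num.min (Gamma (nu + 0%:R + 1)) (Gamma (nu + 1%:R + 1))).
  by rewrite lt_min !g.
case=> [|k]; first by rewrite ge_min lexx.
rewrite ge_min; apply/orP; right; elim: k => // k IH.
rewrite (le_trans IH)// -[k.+2%:R]natr1 addrA [leRHS]GammaS; last first.
  by rewrite -natr1; have := ler0n R k; lra.
by rewrite ler_peMl// ?ltW ?g// -natr1; have := ler0n R k; lra.
Qed.

Lemma besselI_termE nu x k : 0 < x ->
  besselI_term nu x k =
  (x / 2) `^ nu * ((x / 2) ^+ (k.*2) / (k`!%:R * Gamma (nu + k%:R + 1))).
Proof.
move=> x0; have y0 : 0 < x / 2 by rewrite divr_gt0.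
rewrite /besselI_term powRD; last by rewrite (gt_eqF y0) implybT.
rewrite -natrM powR_mulrn ?ltW// mul2n mulrCA mulrA.
by rewrite [_ * _ `^ nu]mulrC mulrA.
Qed.

Lemma is_cvg_besselI nu x : -1 < nu -> 0 < x -> cvgn (series (besselI_term nu x)).
Proof.
move=> nu1 x0; have [c c0 cG] := Gamma_lower_bound nu1.
have y0 : 0 < x / 2 by rewrite divr_gt0.
have G0 k : 0 < Gamma (nu + k%:R + 1) := lt_le_trans c0 (cG k).
apply: (@series_le_cvg _ _ (fun k => (x / 2) `^ nu / c * exp_coeff ((x / 2) ^+ 2) k)).
- move=> k; have y1 := ltW y0; have g := ltW (G0 k).
  by rewrite besselI_termE// mulr_ge0 ?powR_ge0// divr_ge0 ?exprn_ge0// mulr_ge0.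
- move=> k; apply: mulr_ge0; first by rewrite divr_ge0 ?powR_ge0 ?(ltW c0).
  by apply: exp_coeff_ge0; rewrite exprn_ge0// ltW.
- move=> k; rewrite besselI_termE// /exp_coeff/= -mulrA ler_wpM2l ?powR_ge0//.
  rewrite -exprM mul2n invfM [leLHS]mulrA [leLHS]mulrC ler_wpM2r//.
    by rewrite divr_ge0// exprn_ge0// ltW.
  by rewrite lef_pV2 ?posrE.
- rewrite (_ : series _ = fun n => (x / 2) `^ nu / c * series (exp_coeff ((x / 2) ^+ 2)) n).
    by apply: is_cvgM; [exact: is_cvg_cst|exact: is_cvg_series_exp_coeff].
  by apply/funext => n; rewrite /series/= mulr_sumr.
Qed.

Lemma besselI_gt0 nu x : -1 < nu -> 0 < x -> 0 < besselI nu x.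
Proof.
move=> nu1 x0; have [c c0 cG] := Gamma_lower_bound nu1.
have term_gt0 k : 0 < besselI_term nu x k.
  rewrite divr_gt0 ?powR_gt0 ?divr_gt0// mulr_gt0 ?ltr0n ?fact_gt0//.
  exact: lt_le_trans (cG k).
apply: (lt_le_trans (term_gt0 0%N)).
have -> : besselI_term nu x 0 = series (besselI_term nu x) 1 by rewrite /series/= big_nat1.
apply: nondecreasing_cvgn_le; last exact: is_cvg_besselI.
by apply/nondecreasing_seqP => n; rewrite /series/= big_nat_recr//= lerDl ltW.
Qed.

Lemma cvg_odd_subseq (u : nat -> R) : cvgn u -> u K.*2.+1 @[K --> \oo] --> limn u.
Proof.
move=> cu; apply: (@cvg_comp _ _ _ (fun K => K.*2.+1) u _ \oo _ _ cu).
by move=> A [N _ NA]; exists N => // n /= Nn; apply: NA => /=; lia.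
Qed.

Let halfX x k : (x / 2) ^+ k.*2 = x ^+ k.*2 / 4 ^+ k.
Proof. by rewrite expr_div_n -[in 2 ^+ _]mul2n exprM -natrX. Qed.

Lemma even_moment_term p x k : 0 <= p -> 0 < x ->
  x ^+ k.*2 * moment_coef p k.*2 =
  (x / 2) `^ (- (p / 2)) * Gamma (p / 2 + 1) * besselI_term (p / 2) x k.
Proof.
move=> p0 x0; have y0 : 0 < x / 2 by rewrite divr_gt0.
rewrite besselI_termE// /moment_coef odd_double doubleK halfX powRN -addrA natr1.
have P0 := powR_gt0 (p / 2) y0.
have G0 : 0 < Gamma (p / 2 + k.+1%:R) by rewrite Gamma_gt0// ltr_wpDl// divr_ge0.
have f0 : 0 < k`!%:R :> R by rewrite ltr0n fact_gt0.
have F0 : 0 < 4 ^+ k :> R by rewrite exprn_gt0.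
move: (_ `^ _) (4 ^+ k) (k`!%:R) (Gamma (_ + k.+1%:R)) P0 F0 f0 G0 => P F f G P0 F0 f0 G0.
by field; rewrite !gt_eqF.
Qed.

Lemma odd_moment_term p x k : 0 <= p -> 0 < x ->
  x ^+ k.*2.+1 * moment_coef p k.*2.+1 =
  (x / 2) `^ (- (p / 2)) * Gamma (p / 2 + 1) * besselI_term (p / 2 - 1) x k.+1 -
  (x / 2) `^ (- (p / 2)) * (p / 2 * Gamma ((p + 1) / 2) * (x / 2) `^ (- 2^-1)) *
  besselI_term ((p - 1) / 2) x k.+1.
Proof.
move=> p0 x0; have y0 : 0 < x / 2 by rewrite divr_gt0.
have e2 : (k.*2.+1)./2 = k by lia.
have e3 : odd k.*2.+1 by rewrite /= odd_double.
rewrite !besselI_termE// /moment_coef e2 e3.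
rewrite (_ : p / 2 - 1 + k.+1%:R + 1 = p / 2 + k.+1%:R); last by ring.
rewrite (_ : (p - 1) / 2 + k.+1%:R + 1 = (p + 1) / 2 + k.+1%:R); last by field.
rewrite (_ : (p - 1) / 2 = p / 2 - 2^-1); last by field.
rewrite !powRB ?(gt_eqF y0) ?implybT// !powRN powRr1 ?(ltW y0)//.
have q1 := powR_gt0 (p / 2) y0; have q2 := powR_gt0 2^-1 y0.
have q3 : (x / 2) `^ 2^-1 * (x / 2) `^ 2^-1 = x / 2.
  by rewrite -powRD ?(gt_eqF y0) ?implybT// (_ : 2^-1 + 2^-1 = 1) ?powRr1 ?(ltW y0)//; lra.
have G0 : 0 < Gamma (p / 2 + k.+1%:R) by rewrite Gamma_gt0// ltr_wpDl// divr_ge0.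
have H0 : 0 < Gamma ((p + 1) / 2 + k.+1%:R).
  by rewrite Gamma_gt0// ltr_wpDl// divr_ge0// addr_ge0.
have f0 : 0 < k.+1`!%:R :> R by rewrite ltr0n fact_gt0.
have F0 : 0 < 4 ^+ k :> R by rewrite exprn_gt0.
rewrite doubleS 3!exprS halfX.
move: ((x / 2) `^ (p / 2)) ((x / 2) `^ 2^-1) (4 ^+ k) (k.+1`!%:R) q1 q2 q3 F0 f0
  (Gamma (p / 2 + k.+1%:R)) (Gamma (_ + k.+1%:R)) G0 H0
  => P r F f q1 q2 q3 F0 f0 G H G0 H0.
have -> : x = 2 * (r * r) by rewrite q3 mulrCA divff ?mulr1.
by field; rewrite !gt_eqF.
Qed.

Lemma meander_seriesE p x : 0 < p -> 0 < x ->
  meander_series p x =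
  (x / 2) `^ (- (p / 2)) *
    (Gamma (p / 2 + 1) * (besselI (p / 2) x + besselI (p / 2 - 1) x) -
     p / 2 * Gamma ((p + 1) / 2) * (x / 2) `^ (- 2^-1) * besselI ((p - 1) / 2) x).
Proof.
move=> p0 x0; have y0 : 0 < x / 2 by rewrite divr_gt0.
have p2 : 0 < p / 2 by rewrite divr_gt0.
set C1 := (x / 2) `^ (- (p / 2)) * Gamma (p / 2 + 1).
set C2 := (x / 2) `^ (- (p / 2)) * (p / 2 * Gamma ((p + 1) / 2) * (x / 2) `^ (- 2^-1)).
have n1 : -1 < p / 2 by lra.
have n2 : -1 < p / 2 - 1 by lra.
have n3 : -1 < (p - 1) / 2 by lra.
(* A partial sum of length 2K + 1 has K + 1 even and K odd terms. The odd ones match the indices 1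
   to K of the orders p/2 - 1 and (p - 1)/2; the index 0 terms of these two series cancel, since
   with their coefficients both equal (p/2)(x/2)^(-1). *)
have E K : series (fun n => x ^+ n * moment_coef p n) K.*2.+1 =
    C1 * (series (besselI_term (p / 2) x) K.+1 + series (besselI_term (p / 2 - 1) x) K.+1) -
    C2 * series (besselI_term ((p - 1) / 2) x) K.+1.
  elim: K => [|K IH].
    rewrite /series/= !big_nat1 !besselI_termE// !expr0 fact0 !mul1r !addr0.
    rewrite /moment_coef/= expr0 fact0 !mul1r subrK.
    have g1 := Gamma_gt0 p2; have h0 : 0 < (p + 1) / 2 by lra.
    have h1 := Gamma_gt0 h0; have h2 : 0 < p / 2 + 1 by lra.
    have h3 := Gamma_gt0 h2.
    rewrite (_ : (p - 1) / 2 + 1 = (p + 1) / 2); last by field.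
    rewrite (_ : (p - 1) / 2 = p / 2 - 2^-1); last by field.
    rewrite /C1 /C2 !powRB ?(gt_eqF y0) ?implybT// !powRN powRr1 ?(ltW y0)// GammaS//.
    have q1 := powR_gt0 (p / 2) y0; have q2 := powR_gt0 2^-1 y0.
    have q3 : (x / 2) `^ 2^-1 * (x / 2) `^ 2^-1 = x / 2.
      by rewrite -powRD ?(gt_eqF y0) ?implybT// (_ : 2^-1 + 2^-1 = 1) ?powRr1 ?(ltW y0)//; lra.
    move: (Gamma (p / 2)) (Gamma ((p + 1) / 2)) g1 h1 => G G' g1 h1.
    move: ((x / 2) `^ (p / 2)) ((x / 2) `^ 2^-1) q1 q2 q3 => P r q1 q2 <-.
    by field; rewrite !gt_eqF.
  rewrite doubleS 2!seriesSr IH ![series _ K.+2]seriesSr.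
  by rewrite (odd_moment_term _ (ltW p0))// -doubleS (even_moment_term _ (ltW p0))// -/C1 -/C2; ring.
transitivity (C1 * (besselI (p / 2) x + besselI (p / 2 - 1) x) - C2 * besselI ((p - 1) / 2) x);
  last by rewrite /C1 /C2; ring.
apply: (@cvg_unique _ (@Rhausdorff R) _ _ _ _ (cvg_odd_subseq (is_cvg_meander_series (ltW p0) (ltW x0)))).
rewrite (funext E).
apply: cvgB; apply: cvgM; try exact: cvg_cst.
  by apply: cvgD; rewrite cvg_shiftS; exact: is_cvg_besselI.
by rewrite cvg_shiftS; exact: is_cvg_besselI.
Qed.

(** At p = 0 the order p/2 - 1 is -1, out of reach of [is_cvg_besselI]. Its terms from index 1 on
    are those of order 1 from index 0 on, and the other odd part carries the factor p/2 = 0. *)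
Lemma meander_series0E x : 0 < x -> meander_series 0 x = besselI 0 x + besselI 1 x.
Proof.
move=> x0; have y0 : 0 < x / 2 by rewrite divr_gt0.
have ee k : x ^+ k.*2 * moment_coef 0 k.*2 = besselI_term 0 x k.
  by rewrite even_moment_term// mul0r oppr0 powRr0 add0r Gamma1 !mul1r.
have oo k : x ^+ k.*2.+1 * moment_coef 0 k.*2.+1 = besselI_term 1 x k.
  rewrite odd_moment_term// !mul0r oppr0 powRr0 add0r Gamma1 !mul1r mul0r subr0 sub0r.
  rewrite !besselI_termE// powR_inv1 ?(ltW y0)// powRr1 ?(ltW y0)//.
  rewrite (_ : -1 + k.+1%:R + 1 = k.+1%:R); last by ring.
  rewrite (_ : 1 + k%:R = k.+1%:R); last by rewrite nat1r.
  have G0 : 0 < Gamma k.+1%:R :> R by rewrite Gamma_gt0.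
  have -> : Gamma (k.+1%:R + 1) = k.+1%:R * Gamma k.+1%:R :> R by rewrite GammaS.
  rewrite factS natrM doubleS 2!exprS.
  have f0 : 0 < k`!%:R :> R by rewrite ltr0n fact_gt0.
  have k0 : 0 < k.+1%:R :> R by [].
  move: (x / 2) (_ ^+ _) (k`!%:R) (k.+1%:R : R) (Gamma _) y0 f0 k0 G0 => y Y f l G y0 f0 l0 G0.
  by field; rewrite !gt_eqF.
have E K : series (fun n => x ^+ n * moment_coef 0 n) K.*2.+1 =
    series (besselI_term 0 x) K.+1 + series (besselI_term 1 x) K.
  elim: K => [|K IH].
    by rewrite /series/= !big_nat1 big_geq// addr0; exact: (ee 0%N).
  by rewrite doubleS 2!seriesSr IH [series _ K.+2]seriesSr
    [series (besselI_term 1 x) K.+1]seriesSr oo -doubleS ee; ring.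
apply: (@cvg_unique _ (@Rhausdorff R) _ _ _ _ (cvg_odd_subseq (is_cvg_meander_series (lexx 0) (ltW x0)))).
rewrite (funext E).
apply: cvgD; last by apply: is_cvg_besselI.
by rewrite cvg_shiftS; exact: is_cvg_besselI.
Qed.

End bessel.

(** * Discretised telegraph paths *)

Lemma measurable_to_nat d (T : measurableType d) (D : set T) (f : T -> nat) :
  measurable D -> (forall k, measurable (D `&` f @^-1` [set k])) -> measurable_fun D f.
Proof.
move=> mD mf _ Y _.
have -> : D `&` f @^-1` Y = \bigcup_(k in Y) (D `&` f @^-1` [set k]).
  apply/seteqP; split => x /=; first by move=> [Dx Yx]; exists (f x).
  by move=> [k Yk [Dx /= fx]]; split; rewrite //= fx.
exact: bigcup_measurable.
Qed.

Lemma Rintegral_cst_itv {R : realType} (r a b : R) : a <= b ->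
  \int[@lebesgue_measure R]_(u in `]a, b]) cst r u = r * (b - a).
Proof.
move=> ab; rewrite Rintegral_cst//; congr (_ * _).
transitivity (fine (lebesgue_measure (`]a, b]%classic : set R))) => //.
rewrite lebesgue_measure_itv/= lte_fin.
by have [->|ba] := eqVneq a b; rewrite ?ltxx ?subrr// lt_neqAle ba ab.
Qed.

Section path.
Context {R : realType}.
Local Notation mu := (@lebesgue_measure R).
Variables (n : R -> nat) (v : R).
Hypothesis n0 : n 0 = 0%N.
Hypothesis nd : forall s u, 0 <= s -> s <= u -> (n s <= n u)%N.

Let V (u : R) : R := v * (- 1) ^+ n u.
Let T (s : R) : R := \int[mu]_(u in `[0, s]) V u.

Let normV u : `|V u| = `|v|.
Proof. by rewrite /V normrM normrX normrN1 expr1n mulr1. Qed.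

Let measurable_V (D : set R) : measurable D -> (forall u, D u -> 0 <= u) ->
  measurable_fun D V.
Proof.
move=> mD D0; apply: measurable_funM => //.
apply: (@measurable_comp _ _ _ _ _ _ setT (fun k => (-1) ^+ k : R) _ n) => //.
apply: measurable_to_nat => // k.
(* Monotonicity of [n] is known on the nonnegative half-line only; the truncation extends it to the
   whole line. *)
pose f (u : R) : R := (n (Num.max u 0))%:R.
have mf : measurable_fun D f.
  apply: nondecreasing_measurable => // x y xy; rewrite ler_nat nd//.
    by rewrite le_max lexx orbT.
  by rewrite ge_max !le_max xy lexx orbT.
have -> : D `&` n @^-1` [set k] = D `&` f @^-1` [set k%:R].
  apply/seteqP; split => x /= [Dx]; rewrite /f max_l ?D0//; first by move=> ->.
  by move=> /eqP; rewrite eqr_nat => /eqP.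
exact: mf.
Qed.

Let integrable_V (i : interval R) : (forall u, u \in i -> 0 <= u) ->
  (mu [set` i] < +oo)%E -> mu.-integrable [set` i] (EFin \o V).
Proof.
move=> i0 ifin; apply: measurable_bounded_integrable => //.
  by apply: measurable_V => // u /= /i0.
exists `|v|; split; first exact: num_real.
by move=> y vy u _; rewrite /= normV ltW.
Qed.

Let telegraphB a b : 0 <= a -> a <= b -> T b - T a = \int[mu]_(u in `]a, b]) V u.
Proof.
move=> a0 ab; rewrite /T Rintegral_itvB// ?bnd_simp//.
apply: integrable_V; first by move=> u; rewrite in_itv/= => /andP[].
by rewrite lebesgue_measure_itv/=; case: ifP => // _; rewrite -EFinB ltry.
Qed.

Lemma telegraph_lipschitz a b : 0 <= a -> a <= b -> `|T b - T a| <= `|v| * (b - a).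
Proof.
move=> a0 ab; rewrite telegraphB//.
have fin : (mu `]a, b] < +oo)%E.
  by rewrite lebesgue_measure_itv/=; case: ifP => // _; rewrite -EFinB ltry.
have i0 u : u \in `]a, b] -> 0 <= u.
  by rewrite in_itv/= => /andP[au _]; rewrite ltW// (le_lt_trans a0).
rewrite (le_trans (le_normr_Rintegral _ _))//; first exact: integrable_V.
rewrite (@eq_Rintegral _ _ _ mu _ (cst `|v|)); last by move=> u _; rewrite /= normV.
by rewrite Rintegral_cst_itv.
Qed.

(** Without a switch the velocity is constant and the error is 0. Otherwise both displacements are
    at most [|v| (b - a)] in size, and the factor [n b - n a >= 1] pays for them; it also makes the
    errors telescope. *)
Lemma telegraph_local a b : 0 <= a -> a <= b ->
  `|T b - T a - (b - a) * V a| <= 2 * `|v| * (b - a) * (n b - n a)%:R.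
Proof.
move=> a0 ab; have nab := nd a0 ab; have [e|e] := eqVneq (n b) (n a).
  rewrite e subnn mulr0 normr_le0 subr_eq0; apply/eqP.
  rewrite telegraphB// (@eq_Rintegral _ _ _ mu _ (cst (V a))).
    by rewrite Rintegral_cst_itv// mulrC.
  move=> u; rewrite inE/= in_itv/= => /andP[au ub].
  rewrite /V (_ : n u = n a)//; apply/eqP; rewrite eqn_leq -{1}e.
  by rewrite !nd// ?(ltW au)// (le_trans a0)// ltW.
apply: (@le_trans _ _ (2 * `|v| * (b - a))); last first.
  by rewrite ler_peMr ?mulr_ge0 ?subr_ge0// ler1n subn_gt0 ltn_neqAle eq_sym e.
rewrite (le_trans (ler_normB _ _))// normrM normV ger0_norm ?subr_ge0//.
by have := telegraph_lipschitz a0 ab; lra.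
Qed.

Lemma telegraph0 : T 0 = 0.
Proof. by rewrite /T set_itv1 Rintegral_set1. Qed.

Definition path_sum (h : R) (j : nat) : R := h * \sum_(i < j) V (i%:R * h).

(** The bound depends on the number of switches rather than on the number j of cells, so on each
    path it vanishes with h. *)
Lemma path_sum_approx h j : 0 <= h ->
  `|T (j%:R * h) - path_sum h j| <= 2 * `|v| * h * (n (j%:R * h))%:R.
Proof.
move=> h0; elim: j => [|j IH].
  by rewrite mul0r telegraph0 /path_sum big_ord0 mulr0 subrr normr0 !mulr_ge0.
have a0 : 0 <= j%:R * h by rewrite mulr_ge0.
have ab : j%:R * h <= j.+1%:R * h by rewrite ler_wpM2r// ler_nat.
have H := telegraph_local a0 ab.
rewrite -mulrBl -natrB// subSnn mul1r natrB ?nd// in H.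
have -> : T (j.+1%:R * h) - path_sum h j.+1 =
  (T (j%:R * h) - path_sum h j) + (T (j.+1%:R * h) - T (j%:R * h) - h * V (j%:R * h)).
  by rewrite /path_sum big_ord_recr/=; ring.
rewrite (le_trans (ler_normD _ _))//.
by move: IH H; lra.
Qed.

Lemma path_sum_approx_at h s : 0 < h -> 0 <= s ->
  `|T s - path_sum h (Num.truncn (s / h))| <= `|v| * h * (2 * (n s)%:R + 1).
Proof.
move=> h0 s0; set j := Num.truncn (s / h).
have sh0 : 0 <= s / h by rewrite divr_ge0// ltW.
have /andP[j1 j2] := truncn_itv sh0; rewrite -/j ler_pdivlMr// in j1 *.
rewrite -/j ltr_pdivrMr// in j2.
have a0 : 0 <= j%:R * h by rewrite mulr_ge0// ltW.
have := path_sum_approx j (ltW h0); have := telegraph_lipschitz a0 j1.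
have : `|v| * (s - j%:R * h) <= `|v| * h.
  by rewrite ler_wpM2l// lerBlDr -[leRHS]addrC -{2}(mul1r h) -mulrDl natr1 ltW.
have : 2 * `|v| * h * (n (j%:R * h))%:R <= 2 * `|v| * h * (n s)%:R.
  by rewrite ler_wpM2l ?mulr_ge0 ?(ltW h0)// ler_nat nd.
have -> : T s - path_sum h j = (T s - T (j%:R * h)) + (T (j%:R * h) - path_sum h j) by ring.
by have := ler_normD (T s - T (j%:R * h)) (T (j%:R * h) - path_sum h j); lra.
Qed.

End path.

(** * Words followed by a sample path *)

Section follows.
Context {R : realType}.
Implicit Types (n : R -> nat) (h v : R) (s : seq bool) (r : nat).

(** Letters are booleans, so a path with an increment of 2 or more in one of these cells follows no
    word of that size. *)
Fixpoint follows n h s : Prop :=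
  if s is b :: s' then
    follows n h s' /\ (n ((size s)%:R * h)%R - n ((size s')%:R * h)%R)%N = b
  else True.

(** The same event as [follows] for counting paths, but phrased by values at single times: in this
    form it is visibly a cylinder set, as independence from V0 demands. *)
Fixpoint visits h s n : Prop :=
  if s is _ :: s' then visits h s' n /\ n ((size s)%:R * h) = flips s else True.

Lemma followsP n h s :
  follows n h s <-> forall i, (i < size s)%N ->
    (n (i.+1%:R * h)%R - n (i%:R * h)%R)%N = nth false (rev s) i.
Proof.
elim: s => [|b s IH]; first by split.
rewrite rev_cons; split.
- move=> [/IH fs e] i; rewrite [size _]/= ltnS leq_eqVlt => /predU1P[->|si].
    by rewrite nth_rcons size_rev ltnn eqxx.
  by rewrite nth_rcons size_rev si fs.
- move=> f; split; last by rewrite f// nth_rcons size_rev ltnn eqxx.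
  apply/IH => i si; rewrite f ?nth_rcons ?size_rev ?si//=.
  exact: ltnW.
Qed.

Lemma follows_inj n h s s' : size s = size s' -> follows n h s -> follows n h s' -> s = s'.
Proof.
elim: s s' => [|b s IH] [|b' s']//= [ss] [fs e] [fs' e']; congr cons; last exact: IH.
by move: e; rewrite ss e'; case: (b); case: (b').
Qed.

Section one_path.
Variables (n : R -> nat) (h : R).
Hypothesis n0 : n 0 = 0%N.
Hypothesis nd : forall a b, 0 <= a -> a <= b -> (n a <= n b)%N.
Hypothesis h0 : 0 <= h.

Lemma follows_flips s : follows n h s -> n ((size s)%:R * h) = flips s.
Proof.
elim: s => [|b s IH]; first by rewrite mul0r.
move=> [/IH e1 e2]; rewrite /flips/= -/(flips s) -e1 -e2 subnK//.
by rewrite nd ?mulr_ge0// ler_wpM2r// ler_nat.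
Qed.

Lemma follows_visits s : follows n h s <-> visits h s n.
Proof.
elim: s => [|b s IH] //; split.
  move=> fs; split; last exact: follows_flips.
  by apply/IH; case: fs.
move=> [/IH fs e]; split=> //; rewrite e (follows_flips fs).
by rewrite /flips/= addnK.
Qed.

Variable v : R.

Lemma follows_path_sum s : follows n h s ->
  path_sum n v h (size s).+1 = v * h * (2 * (ups s)%:R - (size s).+1%:R).
Proof.
elim: s => [|b s IH].
  by move=> _; rewrite /path_sum big_ord1/= mul0r n0 expr0; ring.
move=> fs; have e := follows_flips fs; have [/IH E _] := fs.
have -> : path_sum n v h (size (b :: s)).+1 =
    path_sum n v h (size s).+1 + h * (v * (-1) ^+ n ((size (b :: s))%:R * h)).
  by rewrite /path_sum [in LHS]big_ord_recr/= mulrDr.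
rewrite E [ups _]/= [size (_ :: _)]/=; rewrite [size _]/= in e.
rewrite e -signr_odd natrD -[(size s).+2%:R]nat1r -[(size s).+1%:R]nat1r.
by case: odd => /=; rewrite ?expr0 ?expr1; ring.
Qed.

Lemma follows_above r s : 0 < v * h -> follows n h s ->
  above r s <-> forall j, (j <= (size s).+1)%N -> - (v * h * r%:R) <= path_sum n v h j.
Proof.
move=> vh; have r0 : - (v * h * r%:R) <= 0 by rewrite oppr_le0 mulr_ge0 ?(ltW vh).
elim: s => [|b s IH].
  move=> _; split => // _ j; case: j => [|[|//]] _; first by rewrite /path_sum big_ord0 mulr0.
  rewrite (@follows_path_sum [::])//= (le_trans r0)//.
  by rewrite (_ : v * h * _ = v * h) ?(ltW vh)//; ring.
move=> fs; have [/IH{}IH _] := fs.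
have last_step : ((size (b :: s)).+1 <= (ups (b :: s)).*2 + r)%N <->
    - (v * h * r%:R) <= path_sum n v h (size (b :: s)).+1.
  rewrite follows_path_sum// -mulrN ler_pM2l// lerBrDl lerBlDr -natrM -natrD ler_nat.
  by rewrite mul2n.
split.
  move=> /andP[/IH as_ /last_step l] j; rewrite leq_eqVlt => /predU1P[->//|]; exact: as_.
move=> hj; apply/andP; split; last by apply/last_step/hj.
by apply/IH => j js; apply: hj; exact: leqW.
Qed.

End one_path.
End follows.

(** * Probability of a word *)

Section law.
Context {d : measure_display} {Omega : measurableType d} {R : realType}.
Variables (P : probability Omega R) (lambda c : R).
Variables (N : R -> Omega -> nat) (V0 : Omega -> R).
Hypothesis lambda0 : 0 < lambda.
Hypothesis NP : poisson_process P lambda N.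
Hypothesis V0U : uniform_sign P c V0.
Hypothesis V0N : independent_of_process P V0 N.

Lemma sum_nth_flips (s : seq bool) :
  (\sum_(i < size s) nat_of_bool (nth false (rev s) i))%N = flips s.
Proof.
rewrite -size_rev /flips -(count_rev id) -sum1_count.
rewrite -(big_mkord xpredT (fun i => nat_of_bool (nth false (rev s) i))).
rewrite -(big_nth false xpredT (fun b => nat_of_bool b)) [RHS]big_mkcond/=.
by apply: eq_bigr => -[].
Qed.

Lemma prob_follows h s : 0 < h ->
  P [set w | follows (N ^~ w) h s] =
  ((lambda * h) ^+ flips s * expR (- (lambda * h)) ^+ size s)%:E.
Proof.
move=> h0; pose S (j : nat) : R := j%:R * h.
have S0 : 0 <= S 0%N by rewrite /S mul0r.
have Snd : nondecreasing_seq S by move=> i j ij; rewrite /S ler_wpM2r ?(ltW h0)// ler_nat.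
have := @poisson_independent_increments _ _ _ P lambda N NP (size s) S S0 Snd.
pose A (i : 'I_(size s)) : set nat := [set nat_of_bool (nth false (rev s) i)].
move=> /(_ A (fun _ => I)).
have -> : \bigcap_(i in [set: 'I_(size s)])
   ((fun w => N (S i.+1) w - N (S i) w)%N @^-1` A i) = [set w | follows (N ^~ w) h s].
  apply/seteqP; split => w /=.
    by move=> Hw; apply/followsP => i si; exact: (Hw (Ordinal si)).
  by move=> /followsP Hw i _; exact: Hw.
move=> ->.
have y0 : 0 < lambda * h by rewrite mulr_gt0.
rewrite (eq_bigr (fun i : 'I_(size s) =>
   ((lambda * h) ^+ nth false (rev s) i * expR (- (lambda * h)))%:E)); last first.
  move=> i _; rewrite /A.
  have -> : (fun w => N (S i.+1) w - N (S i) w)%N @^-1` [set nat_of_bool (nth false (rev s) i)] =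
     [set w | (N (S i.+1) w - N (S i) w)%N = nth false (rev s) i] by [].
  rewrite (poisson_increments NP); last 2 first.
  - by rewrite mulr_ge0// ltW.
  - by rewrite /S ltr_pM2r// ltr_nat.
  (* The factorial in the Poisson weight is 0! or 1!, so the weights multiply to a power of
     [lambda * h] that depends only on the number of switches. *)
  rewrite /poisson_pmf /S -mulrBl -natrB// subSnn mul1r y0.
  by case: nth; rewrite /= ?fact0 ?invr1 ?mulr1.
rewrite prodEFin; congr EFin.
by rewrite big_split/= prodr_const card_ord -(sum_nth_flips s) expr_sum.
Qed.

Lemma visits_cylinder (h : R) s : 0 <= h -> cylinder_sigma `[0, +oo[ (visits h s).
Proof.
move=> h0; rewrite /cylinder_sigma; set G := (X in <<s X >>).
elim: s => [|b s IH].
  exact: (@measurableT _ (g_sigma_algebraType G)).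
apply: (@measurableI _ (g_sigma_algebraType G) (visits h s)
  [set n | n ((size (b :: s))%:R * h) = flips (b :: s)]) => //.
apply: sub_gen_smallest; exists ((size (b :: s))%:R * h).
  by rewrite /= in_itv/= andbT mulr_ge0.
by exists [set flips (b :: s)].
Qed.

Lemma prob_start_follows h s : 0 < h ->
  P [set w | V0 w = c /\ follows (N ^~ w) h s] =
  (2^-1 * ((lambda * h) ^+ flips s * expR (- (lambda * h)) ^+ size s))%:E.
Proof.
move=> h0; rewrite EFinM -prob_follows//; have [_ <- _] := V0U.
have e (w : Omega) : follows (N ^~ w) h s <-> visits h s (N ^~ w).
  apply: follows_visits; last exact: ltW.
  - exact: (poisson_start NP).
  - exact: (poisson_nondecreasing NP).
have -> : [set w | follows (N ^~ w) h s] = [set w | visits h s (N ^~ w)].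
  by apply/seteqP; split => w /= /e.
rewrite -(V0N (A := [set c])) //; last exact: visits_cylinder (ltW h0).
by congr (P _); apply/seteqP; split => w /= [-> /e].
Qed.

Lemma measurable_increment (a b : R) (k : nat) : 0 <= a -> 0 <= b ->
  measurable [set w | (N b w - N a w)%N = k].
Proof.
move=> a0 b0.
have -> : [set w | (N b w - N a w)%N = k] = (fun w => N b w - N a w)%N @^-1` [set k] by [].
rewrite -[X in measurable X]setTI.
apply: (measurable_fun_subn (poisson_measurable NP b0) (poisson_measurable NP a0)) => //.
Qed.

Lemma measurable_follows h s : 0 <= h -> measurable [set w | follows (N ^~ w) h s].
Proof.
move=> h0; elim: s => [|b s IH]; first exact: measurableT.
apply: measurableI => //; apply: measurable_increment; exact: mulr_ge0.
Qed.

End law.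

(** * Comparison of the process with its discretisations *)

Section bounded_integral.
Context {d : measure_display} {Omega : measurableType d} {R : realType}.
Variable P : probability Omega R.

Lemma bounded_integrable (f : Omega -> R) (K : R) : measurable_fun setT f ->
  (forall w, `|f w| <= K) -> P.-integrable setT (EFin \o f).
Proof.
move=> mf fK; apply: measurable_bounded_integrable => //.
  by apply: (le_lt_trans (probability_le1 P measurableT)); exact: ltry.
exists K; split; first exact: num_real.
by move=> y Ky w _; rewrite /= (le_trans (fK w))// ltW.
Qed.

Lemma bounded_cvg0 (u : nat -> Omega -> R) (K : R) :
  (forall r, measurable_fun setT (u r)) -> (forall r w, `|u r w| <= K) ->
  (forall w, u r w @[r --> \oo] --> 0) ->
  (\int[P]_w u r w) @[r --> \oo] --> 0.
Proof.
move=> mu uK cu.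
have := @dominated_cvg _ _ _ P setT measurableT (fun r w => (u r w)%:E) (cst 0%E) (cst K%:E).
rewrite integral_cst// mul0e => H.
have : (\int[P]_w (u r w)%:E @[r --> \oo] --> 0)%E.
  apply: H => //.
  - by move=> r; apply: measurableT_comp.
  - by move=> w _; apply: cvg_EFin; [exact: nearW|exact: cu].
  - rewrite (_ : cst K%:E = EFin \o cst K)//.
    exact: (@bounded_integrable _ `|K|).
  - by move=> r w _; rewrite abse_EFin lee_fin.
by move=> /fine_cvg.
Qed.

End bounded_integral.

Section telegraph_law.
Context {d : measure_display} {Omega : measurableType d} {R : realType}.
Variables (P : probability Omega R) (lambda c : R).
Variables (N : R -> Omega -> nat) (V0 : Omega -> R).
Hypothesis lambda0 : 0 < lambda.
Hypothesis c0 : 0 < c.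
Hypothesis NP : poisson_process P lambda N.
Hypothesis V0U : uniform_sign P c V0.
Hypothesis V0N : independent_of_process P V0 N.

Let n0 w : (N ^~ w) 0 = 0%N. Proof. exact: (poisson_start NP). Qed.
Let nd w a b : 0 <= a -> a <= b -> ((N ^~ w) a <= (N ^~ w) b)%N.
Proof. exact: (poisson_nondecreasing NP). Qed.

Let X h j w : R := path_sum (N ^~ w) (V0 w) h j.

Let telegraph_approx h s w : 0 < h -> 0 <= s ->
  `|telegraph N V0 s w - X h (Num.truncn (s / h)) w| <= `|V0 w| * h * (2 * (N s w)%:R + 1).
Proof. by move=> h0 s0; exact: (path_sum_approx_at (V0 w) (@nd w) h0 s0). Qed.

Let measurable_X h j : 0 <= h -> measurable_fun setT (X h j).
Proof.
have [mV _ _] := V0U; move=> h0; apply: measurable_funM; first exact: measurable_cst.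
apply: measurable_sum => i; apply: measurable_funM; first exact: mV.
apply: (@measurable_comp _ _ _ _ _ _ setT (fun k => (-1) ^+ k : R) _ (N (i%:R * h))) => //.
by apply: (poisson_measurable NP); rewrite mulr_ge0.
Qed.

Let cvg_inv_step (s C : R) : s / r.+1%:R * C @[r --> \oo] --> (0 : R).
Proof.
rewrite -[X in _ --> X](mul0r C); apply: cvgM; last exact: cvg_cst.
rewrite -[X in _ --> X](mulr0 s); apply: cvgM; first exact: cvg_cst.
exact: cvg_harmonic.
Qed.

Lemma measurable_telegraph s : 0 <= s -> measurable_fun setT (telegraph N V0 s).
Proof.
rewrite le_eqVlt => /predU1P[<-|s0].
  by rewrite (_ : telegraph N V0 0 = cst 0)//; apply/funext => w; exact: telegraph0.
apply: (@measurable_fun_cvg _ _ _ _ (fun r => X (s / r.+1%:R) r.+1)).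
  by move=> r; apply: measurable_X; rewrite divr_ge0// ltW.
move=> w _; apply/cvgrPdist_le => e e0.
have := cvg_inv_step (s * `|V0 w|) (2 * (N s w)%:R + 1).
move=> /cvgrPdist_le /(_ _ e0); apply: filterS => r; rewrite sub0r normrN => h.
have h0 : 0 < s / r.+1%:R by rewrite divr_gt0.
have := telegraph_approx w h0 (ltW s0).
have -> : s / (s / r.+1%:R) = r.+1%:R by rewrite invf_div mulrCA divff ?mulr1// gt_eqF.
rewrite natrK => H; rewrite (le_trans H)// (le_trans _ h)// (le_trans _ (ler_norm _))//.
by rewrite mulrA [`|V0 w| * s]mulrC.
Qed.

(** Paths are Lipschitz, so nonnegativity at the countably many points j t / (r + 1) suffices. *)
Lemma measurable_telegraph_nonneg t : 0 <= t -> measurable (telegraph_nonneg N V0 t).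
Proof.
move=> t0.
have -> : telegraph_nonneg N V0 t = \bigcap_r \bigcap_(j in [set j : nat | (j <= r.+1)%N])
    [set w | 0 <= telegraph N V0 (j%:R * (t / r.+1%:R)) w].
  apply/seteqP; split => w.
    move=> Dw r _ j /= jr; apply: Dw; rewrite mulr_ge0 ?divr_ge0//=.
    by rewrite mulrCA ler_piMr// ler_pdivrMr// mul1r ler_nat.
  move=> H s /andP[s0 st]; rewrite leNgt; apply/negP => Ts.
  have t1 : 0 < t.
    rewrite lt_neqAle t0 andbT; apply/eqP => t00; move: Ts.
    have -> : s = 0 by apply/eqP; rewrite eq_le s0 t00 st.
    by rewrite [telegraph _ _ _ _]telegraph0 ltxx.
  have := cvg_inv_step (t * `|V0 w|) 1.
  (* On a grid whose cells allow a displacement of at most half of [- T(s)], the path is still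
     negative at the grid point just before s. *)
  have e0 : 0 < - telegraph N V0 s w / 2 by rewrite divr_gt0 ?oppr_gt0.
  move=> /cvgrPdist_le /(_ _ e0) [r _ /(_ r (leqnn r))]; rewrite sub0r normrN => hr.
  pose h := t / r.+1%:R; have h0 : 0 < h by rewrite divr_gt0.
  pose j := Num.truncn (s / h); have sh : 0 <= s / h by rewrite divr_ge0// ltW.
  have /andP[j1 j2] := truncn_itv sh; rewrite -/j ler_pdivlMr// in j1 *.
  rewrite -/j ltr_pdivrMr// in j2.
  have jr : (j <= r.+1)%N.
    rewrite -(ler_nat R) (le_trans (_ : _ <= s / h)) ?ler_pdivlMr//.
    by rewrite ler_pdivrMr// /h mulrCA divff ?mulr1// pnatr_eq0.
  have := H r I j jr; rewrite /= -/h => Tj.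
  have a0 : 0 <= j%:R * h by rewrite mulr_ge0// ltW.
  have := telegraph_lipschitz (V0 w) (@nd w) a0 j1.
  rewrite -!/(telegraph N V0 _ w) => L.
  have : `|V0 w| * (s - j%:R * h) <= `|V0 w| * h.
    by rewrite ler_wpM2l//; move: j2; rewrite -natr1 mulrDl mul1r; lra.
  have : `|V0 w| * h <= - telegraph N V0 s w / 2.
    rewrite (le_trans _ hr)// (le_trans _ (ler_norm _))// mulr1 /h.
    by rewrite mulrCA mulrA.
  move: L; rewrite ler_norml => /andP[L1 L2].
  rewrite /telegraph/velocity in L1 Tj Ts *.
  by lra.
apply: bigcapT_measurable => r; apply: bigcap_measurable; first by exists 0%N.
move=> j _; have a0 : 0 <= j%:R * (t / r.+1%:R) by rewrite mulr_ge0// divr_ge0.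
rewrite [X in measurable X](_ : _ = setT `&` telegraph N V0 (j%:R * (t / r.+1%:R)) @^-1` `[0, +oo[).
  exact: measurable_telegraph.
by apply/seteqP; split => w /=; rewrite in_itv/= andbT; [|case].
Qed.

Let grid_event h s : set Omega := [set w | V0 w = c /\ follows (N ^~ w) h s].

Definition grid_sum (F : seq bool -> R) m h (w : Omega) : R :=
  \sum_(s <- bits m) F s * \1_(grid_event h s) w.

Let measurable_grid_event h s : 0 <= h -> measurable (grid_event h s).
Proof.
move=> h0; have [mV _ _] := V0U.
have -> : grid_event h s = (setT `&` V0 @^-1` [set c]) `&` [set w | follows (N ^~ w) h s].
  by apply/seteqP; split => w /=; rewrite /grid_event/=; tauto.
by apply: measurableI; [exact: mV|exact: measurable_follows NP _ _ h0].
Qed.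

Lemma measurable_grid_sum F m h : 0 <= h -> measurable_fun setT (grid_sum F m h).
Proof.
move=> h0; apply: measurable_sum => s; apply: measurable_funM; first exact: measurable_cst.
exact: measurable_indic (measurable_grid_event s h0).
Qed.

(** Distinct words of one size give disjoint events, so at most one term survives. The word is found
    before F, which allows [upper] and [simple] to be evaluated at w on the same word. *)
Lemma grid_sum_cases m h w :
  (exists2 s, size s = m /\ grid_event h s w & forall F, grid_sum F m h w = F s) \/
  (forall F, grid_sum F m h w = 0).
Proof.
have [[s [sm ws]]|no] := pselect (exists s, size s = m /\ grid_event h s w); [left|right].
  exists s => // F; rewrite /grid_sum (bigD1_seq s) ?uniq_bits ?mem_bits ?sm//=.
  rewrite indicE mem_set// mulr1 big_seq_cond big1 ?addr0// => s' /andP[].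
  rewrite mem_bits => /eqP sm' ss'; rewrite indicE memNset ?mulr0// => -[_ fs'].
  case: ws => _ fs; move/negP: ss'; apply; apply/eqP.
  by apply: (follows_inj _ fs' fs); rewrite sm sm'.
move=> F; rewrite /grid_sum big_seq big1// => s; rewrite mem_bits => /eqP sm.
by rewrite indicE memNset ?mulr0// => ws; apply: no; exists s.
Qed.

Lemma Rintegral_grid_sum F m h : 0 < h -> (forall s, 0 <= F s) ->
  \int[P]_w grid_sum F m h w =
  2^-1 * expR (- (lambda * h)) ^+ m * \sum_(s <- bits m) (lambda * h) ^+ flips s * F s.
Proof.
move=> h0 F0; rewrite /Rintegral.
have -> : (\int[P]_w (grid_sum F m h w)%:E =
    \int[P]_w \sum_(s <- bits m) (F s * \1_(grid_event h s) w)%:E)%E.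
  by apply: eq_integral => w _; rewrite /grid_sum sumEFin.
have mi s : measurable_fun setT (fun w => (F s * \1_(grid_event h s) w)%:E).
  apply: measurableT_comp => //; apply: measurable_funM; first exact: measurable_cst.
  exact: measurable_indic (measurable_grid_event s (ltW h0)).
rewrite ge0_integral_sum//; last first.
  by move=> s w _; rewrite lee_fin mulr_ge0// indicE.
rewrite (eq_big_seq (fun s => (2^-1 * expR (- (lambda * h)) ^+ m * ((lambda * h) ^+ flips s * F s))%:E)).
  by rewrite sumEFin/= mulr_sumr.
move=> s; rewrite mem_bits => /eqP sm.
under eq_integral do rewrite EFinM.
rewrite ge0_integralZl//=; last 2 first.
- apply: measurableT_comp => //.
  exact: measurable_indic (measurable_grid_event s (ltW h0)).
- by rewrite lee_fin.
rewrite integral_indic//; last exact: measurable_grid_event (ltW h0).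
rewrite setIT; transitivity ((F s)%:E * P (grid_event h s))%E => //.
rewrite /grid_event (prob_start_follows lambda0 NP V0U V0N)// sm -EFinM.
by congr EFin; ring.
Qed.

Variables (t p : R).
Hypotheses (t0 : 0 < t) (p0 : 0 <= p).

(* There are (r + 1)^2 cells, so that the barrier - c h (r + 1) tends to 0 while
   the discretisation error, of order h N(t), is eventually smaller. *)
Let M (r : nat) : nat := (r.+1 * r.+1).-1.
Let h (r : nat) : R := t / (M r).+1%:R.

Let MS r : (M r).+1 = (r.+1 * r.+1)%N. Proof. by rewrite /M; lia. Qed.

Let h0 r : 0 < h r. Proof. by rewrite divr_gt0. Qed.

Let hM r : h r * (M r).+1%:R = t.
Proof. by rewrite /h divfK// pnatr_eq0. Qed.

Let payoff r s : R := pospow p (c * h r * (2 * (ups s)%:R - (M r).+1%:R)).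

Let lower r := grid_sum (fun s => payoff r s * (above 0 s)%:R) (M r) (h r).
Let upper r := grid_sum (fun s => payoff r s * (above r.+1 s)%:R) (M r) (h r).
(** Indicator of the paths that start with velocity c and have at most one jump in each of the first
    [M r] cells. *)
Let simple r := grid_sum (fun=> 1) (M r) (h r).

Let g w : R := pospow p (telegraph N V0 t w) *
  \1_(telegraph_nonneg N V0 t `&` [set w | V0 w = c]) w.

Let bound : R := pospow p (c * t).

Let meander_mass : R :=
  2^-1 * expR (- (lambda * t)) * (pospow p (c * t) * meander_series p (lambda * t)).

Let measurable_g : measurable_fun setT g.
Proof.
have [mV _ _] := V0U; apply: measurable_funM.
  apply: measurableT_comp; last exact: measurable_telegraph (ltW t0).
  by apply: continuous_measurable_fun; exact: continuous_pospow.
apply: measurable_indic; apply: measurableI.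
  exact: measurable_telegraph_nonneg (ltW t0).
have -> : [set w | V0 w = c] = setT `&` V0 @^-1` [set c].
  by apply/seteqP; split => w //= [].
exact: mV.
Qed.

Let cvg_h : h r @[r --> \oo] --> (0 : R).
Proof.
have c1 : t / r.+1%:R @[r --> \oo] --> (0 : R).
  by have := cvg_inv_step t 1; under eq_fun do rewrite mulr1.
apply: (squeeze_cvgr _ (cvg_cst 0) c1); apply: nearW => r.
rewrite (ltW (h0 r))/= /h ler_wpM2l ?(ltW t0)// lef_pV2 ?posrE//.
by rewrite MS ler_nat leq_pmulr.
Qed.

Let cvg_hM C : C * h r @[r --> \oo] --> (0 : R).
Proof. by rewrite -[X in _ --> X](mulr0 C); apply: cvgM; [exact: cvg_cst|exact: cvg_h]. Qed.

Let cvg_path_at_t w : X (h r) (M r).+1 w @[r --> \oo] --> telegraph N V0 t w.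
Proof.
apply/cvgrPdist_le => e e0.
have := cvg_hM (`|V0 w| * (2 * (N t w)%:R + 1)).
move=> /cvgrPdist_le /(_ _ e0); apply: filterS => r; rewrite sub0r normrN => he.
have := telegraph_approx w (h0 r) (ltW t0).
have -> : t / h r = (M r).+1%:R by rewrite -{1}(hM r) mulrAC divff ?mul1r// gt_eqF.
rewrite natrK => /le_trans; apply; rewrite (le_trans _ he)// (le_trans _ (ler_norm _))//.
by rewrite mulrAC.
Qed.

Let cvg_exp : 2^-1 * expR (- (lambda * h r)) ^+ M r @[r --> \oo] --> 2^-1 * expR (- (lambda * t)).
Proof.
apply: cvgM; first exact: cvg_cst.
(* A word of size [M r] constrains only [M r] of the [(M r).+1] cells; the surplus factor e^(lambda
   h) tends to 1. *)
rewrite (_ : (fun r => _) = fun r => expR (lambda * h r - lambda * t)).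
  have H : lambda * h r - lambda * t @[r --> \oo] --> 0 - lambda * t.
    by apply: cvgB; [exact: cvg_hM|exact: cvg_cst].
  rewrite sub0r in H.
  by apply: (@cvg_comp _ _ _ _ expR _ _ _ H); exact: continuous_expR.
apply/funext => r; rewrite -expRM_natl -(hM r) -[(M r).+1%:R]natr1; congr expR; ring.
Qed.

Let cvg_lower : (\int[P]_w lower r w) @[r --> \oo] --> meander_mass.
Proof.
rewrite (_ : (fun r => _) = fun r => 2^-1 * expR (- (lambda * h r)) ^+ M r *
    walk_sum p (M r) (lambda * h r) (c * h r)); last first.
  by apply/funext => r; rewrite Rintegral_grid_sum// => s; rewrite mulr_ge0// pospow_ge0.
apply: cvgM; first exact: cvg_exp.
apply: (@cvg_walk_sum _ _ _ _ _ _ _ (lambda * t)) => //.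
- move=> A [n _ nA]; exists n => // k /= nk; apply: nA => /=; rewrite /M; nia.
- by move=> r; rewrite mulr_ge0 ?ltW.
- by move=> r; rewrite mulr_ge0 ?ltW.
- by move=> r; rewrite -mulrA hM.
- by under eq_fun do rewrite -mulrA hM; exact: cvg_cst.
- by under eq_fun do rewrite -mulrA hM; exact: cvg_cst.
Qed.

Let upper_sum r := 2^-1 * expR (- (lambda * h r)) ^+ M r *
  walk_sum p (M r + r.+1) (lambda * h r) (c * h r).

(* Prepending [r.+1] rising steps turns a walk staying above [- r.+1] into one
   staying above 0. *)
Let upper_le r : \int[P]_w upper r w <= upper_sum r.
Proof.
have y0 : 0 <= lambda * h r by rewrite mulr_ge0 ?ltW.
rewrite Rintegral_grid_sum//; last by move=> s; rewrite mulr_ge0// pospow_ge0.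
rewrite ler_wpM2l ?mulr_ge0 ?exprn_ge0 ?expR_ge0// /walk_sum.
apply: le_trans (sum_bits_cat_nseq _ _ _); last first.
  by move=> s; rewrite mulr_ge0 ?exprn_ge0// mulr_ge0// pospow_ge0.
apply: ler_sum => s _; rewrite flips_cat_nseq above_cat_nseq ups_cat_nseq.
apply: ler_wpM2l; first exact: exprn_ge0.
apply: ler_wpM2r => //; apply: le_pospow => //.
apply: ler_wpM2l; first by rewrite mulr_ge0 ?(ltW c0) ?(ltW (h0 r)).
by rewrite -addSn !natrD; have := ler0n R r.+1; lra.
Qed.

Let cvg_upper_sum : upper_sum r @[r --> \oo] --> meander_mass.
Proof.
apply: cvgM; first exact: cvg_exp.
(* The added rising steps take this much time, which vanishes in the limit thanks to the quadratic
   number of cells. *)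
have hr r : h r * r.+1%:R = t / r.+1%:R.
  by rewrite /h MS natrM; field; rewrite nat1r pnatr_eq0.
have eM C r : C * h r * (M r + r.+1).+1%:R = C * t + C * (t / r.+1%:R).
  by rewrite -addSn natrD mulrDr -(mulrA C (h r) (M r).+1%:R) -(mulrA C (h r) r.+1%:R) hM hr.
have cM C : C * h r * (M r + r.+1).+1%:R @[r --> \oo] --> C * t.
  rewrite (funext (eM C)) -[X in _ --> X]addr0; apply: cvgD; first exact: cvg_cst.
  by under eq_fun do rewrite mulrC; exact: cvg_inv_step.
apply: (@cvg_walk_sum _ _ _ _ _ _ _ (lambda * t + lambda * t)) => //.
- move=> A [n _ nA]; exists n => // k /= nk; apply: nA => /=; rewrite /M; nia.
- by move=> r; rewrite mulr_ge0 ?ltW.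
- by move=> r; rewrite mulr_ge0 ?ltW.
- move=> r; rewrite eM lerD2l ler_wpM2l ?(ltW lambda0)// ler_pdivrMr//.
  by rewrite ler_peMr ?(ltW t0)// ler1n.
Qed.

(** With y = lambda h each cell contributes e^(-y) (1 + y), which lies between e^(-y^2) and 1, and
    (M r) y^2 tends to 0. *)
Let cvg_simple : (\int[P]_w simple r w) @[r --> \oo] --> (2^-1 : R).
Proof.
rewrite (_ : (fun r => _) = fun r => 2^-1 *
    (expR (- (lambda * h r)) * (1 + lambda * h r)) ^+ M r); last first.
  apply/funext => r; rewrite Rintegral_grid_sum// exprMn -mulrA; congr (_ * (_ * _)).
  by under eq_bigr do rewrite mulr1; exact: sum_bits_flips.
rewrite -[X in _ --> X]mulr1; apply: cvgM; first exact: cvg_cst.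
have ce : expR (- (lambda * t * lambda * h r)) @[r --> \oo] --> (1 : R).
  have H : - (lambda * t * lambda * h r) @[r --> \oo] --> (- 0 : R).
    by apply: cvgN; exact: cvg_hM.
  rewrite oppr0 in H; rewrite -expR0.
  by apply: (@cvg_comp _ _ _ _ expR _ _ _ H); exact: continuous_expR.
have sq := squeeze_cvgr _ ce (cvg_cst (1 : R)); apply: sq; apply: nearW => r.
set y := lambda * h r; have y0 : 0 < y by rewrite mulr_gt0.
have b0 : 0 <= expR (- y) * (1 + y) by rewrite mulr_ge0 ?expR_ge0// addr_ge0// ltW.
apply/andP; split; last first.
  by rewrite exprn_ile1// expRN mulrC ler_pdivrMr ?expR_gt0// mul1r expR_ge1Dx.
(* From 1 + y >= e^(y/(1+y)), the reciprocal of e^(-x) >= 1 - x at x = y/(1+y), and y - y/(1+y) =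
   y^2/(1+y) <= y^2. *)
have b1 : expR (- (y * y)) <= expR (- y) * (1 + y).
  have y1 : 0 < 1 + y by rewrite addr_gt0.
  apply: (@le_trans _ _ (expR (- y) * expR (y / (1 + y)))).
    rewrite -expRD ler_expR -subr_ge0.
    rewrite (_ : _ - _ = y * y * y / (1 + y)); last by field; rewrite gt_eqF.
    by rewrite divr_ge0 ?mulr_ge0// ltW.
  rewrite ler_wpM2l ?expR_ge0// -[leRHS]invrK -[leLHS]invrK lef_pV2 ?posrE ?invr_gt0 ?expR_gt0//.
  rewrite -expRN (le_trans _ (expR_ge1Dx _))//.
  by rewrite (_ : 1 + - (y / (1 + y)) = (1 + y)^-1)//; field; rewrite gt_eqF.
apply: (@le_trans _ _ (expR (- (y * y)) ^+ M r)); last first.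
  by rewrite lerXn2r ?nnegrE ?expR_ge0.
rewrite -expRM_natl ler_expR mulrN lerN2.
have -> : lambda * t * lambda * h r = (M r).+1%:R * (y * y) by rewrite /y -(hM r); ring.
apply: ler_wpM2r; first by rewrite mulr_ge0 // ltW.
by rewrite ler_nat.
Qed.

Let payoff01 r s : size s = M r -> 0 <= payoff r s <= bound.
Proof.
move=> sm; rewrite pospow_ge0/= le_pospow//.
have -> : c * t = c * h r * (M r).+1%:R by rewrite -mulrA hM.
apply: ler_wpM2l; first exact: mulr_ge0 (ltW c0) (ltW (h0 r)).
have : (ups s)%:R <= (M r).+1%:R :> R by rewrite ler_nat -sm ups_le.
lra.
Qed.

Let bound0 : 0 <= bound. Proof. exact: pospow_ge0. Qed.

Let g_on w : telegraph_nonneg N V0 t w -> V0 w = c ->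
  g w = pospow p (telegraph N V0 t w).
Proof. by move=> Dw V0w; rewrite /g indicE mem_set ?mulr1. Qed.

Let g_off w : ~ (telegraph_nonneg N V0 t w /\ V0 w = c) -> g w = 0.
Proof. by move=> Dw; rewrite /g indicE memNset ?mulr0. Qed.

Let g01 w : 0 <= g w <= bound.
Proof.
have [[Dw V0w]|Dw] := pselect (telegraph_nonneg N V0 t w /\ V0 w = c); last first.
  by rewrite g_off// lexx bound0.
rewrite g_on// pospow_ge0/= le_pospow//.
have H : `|telegraph N V0 t w - telegraph N V0 0 w| <= `|V0 w| * (t - 0).
  exact: (telegraph_lipschitz (V0 w) (@nd w) (lexx 0) (ltW t0)).
have T0 : telegraph N V0 0 w = 0 by exact: telegraph0.
rewrite T0 !subr0 V0w (gtr0_norm c0) in H.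
exact: le_trans (ler_norm _) H.
Qed.

Let lower01 r w : 0 <= lower r w <= bound.
Proof.
have [[s [sm _] E]|E] := grid_sum_cases (M r) (h r) w; rewrite /lower E; last by rewrite lexx bound0.
by have := payoff01 sm; case: (above 0 s); rewrite ?mulr1 ?mulr0 ?lexx ?bound0.
Qed.

Let upper01 r w : 0 <= upper r w <= bound.
Proof.
have [[s [sm _] E]|E] := grid_sum_cases (M r) (h r) w; rewrite /upper E; last by rewrite lexx bound0.
by have := payoff01 sm; case: (above r.+1 s); rewrite ?mulr1 ?mulr0 ?lexx ?bound0.
Qed.

Let simple01 r w : 0 <= simple r w <= 1.
Proof. by have [[s _ E]|E] := grid_sum_cases (M r) (h r) w; rewrite /simple E lexx ler01. Qed.

Let lower_excess r w := Num.max (lower r w - g w) 0.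
(* The factor [simple] discards the paths followed by no word, on which [upper]
   vanishes. *)
Let upper_defect r w := simple r w * Num.max (g w - upper r w) 0.

Let grid_payoff r s w : size s = M r -> grid_event (h r) s w ->
  payoff r s = pospow p (X (h r) (M r).+1 w).
Proof.
move=> sm [V0w fs]; rewrite /X -sm V0w.
by rewrite (follows_path_sum (n0 w) (@nd w) (ltW (h0 r)) c fs) sm.
Qed.

Let grid_above r k s w : size s = M r -> grid_event (h r) s w ->
  above k s <-> forall j, (j <= (M r).+1)%N -> - (c * h r * k%:R) <= X (h r) j w.
Proof.
move=> sm [V0w fs]; rewrite /X -sm V0w.
by apply: (follows_above (n0 w) (@nd w) (ltW (h0 r))) => //; rewrite mulr_gt0.
Qed.

Let cvg_payoff_gap w :
  `|pospow p (X (h r) (M r).+1 w) - pospow p (telegraph N V0 t w)| @[r --> \oo] --> (0 : R).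
Proof.
have H : pospow p (X (h r) (M r).+1 w) @[r --> \oo] --> pospow p (telegraph N V0 t w).
  by apply: (@cvg_comp _ _ _ _ (pospow p) _ _ _ (@cvg_path_at_t w)); exact: continuous_pospow.
have := cvg_norm (cvgB H (cvg_cst (pospow p (telegraph N V0 t w)))).
by rewrite subrr normr0; apply.
Qed.

Let cvg_lower_excess w : lower_excess r w @[r --> \oo] --> (0 : R).
Proof.
have [Dw|Dw] := pselect (telegraph_nonneg N V0 t w).
  apply: (squeeze_cvgr _ (cvg_cst 0) (@cvg_payoff_gap w)); apply: nearW => r.
  rewrite /lower_excess le_max lexx orbT/= ge_max normr_ge0 andbT.
  have [[s [sm ws] E]|E] := grid_sum_cases (M r) (h r) w; rewrite /lower E; last first.
    by rewrite sub0r (le_trans _ (normr_ge0 _))// oppr_le0; case/andP: (g01 w).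
  rewrite g_on//; last by case: ws.
  rewrite (grid_payoff sm ws) (le_trans _ (ler_norm _))// lerB// ler_piMr ?pospow_ge0//.
  by case: above.
(* A strictly negative value survives discretisation on fine grids, so the word followed, if any, is
   not above 0 and [lower] vanishes. *)
have [s [s0 st] Ts] : exists2 s, 0 <= s /\ s <= t & telegraph N V0 s w < 0.
  apply: contrapT => no; apply: Dw => s /andP[s0 st]; rewrite leNgt; apply/negP => Ts.
  by apply: no; exists s.
apply: cvg_near_cst.
have := cvg_hM (`|V0 w| * (2 * (N s w)%:R + 1)).
have Ts' : 0 < - telegraph N V0 s w by rewrite oppr_gt0.
move=> /cvgrPdist_lt /(_ _ Ts'); apply: filterS => r; rewrite sub0r normrN => he.
rewrite /lower_excess; apply/max_idPr; rewrite lerBlDr add0r.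
have [[l [sm ws] E]|E] := grid_sum_cases (M r) (h r) w; rewrite /lower E; last by case/andP: (g01 w).
have [ab|_] := boolP (above 0 l); last by rewrite mulr0; case/andP: (g01 w).
have /(grid_above 0 sm ws) hX := ab.
have jM : (Num.truncn (s / h r) <= (M r).+1)%N.
  rewrite -(ler_nat R); apply: (@le_trans _ _ (s / h r)).
    by rewrite truncn_le divr_ge0// ltW.
  by rewrite ler_pdivrMr// mulrC hM.
have := hX _ jM; rewrite mulr0 oppr0 => Xj.
have := telegraph_approx w (h0 r) s0; rewrite ler_norml => /andP[L _].
have : `|V0 w| * h r * (2 * (N s w)%:R + 1) < - telegraph N V0 s w.
  by rewrite mulrAC (le_lt_trans (ler_norm _)).
lra.
Qed.

Let cvg_upper_defect w : upper_defect r w @[r --> \oo] --> (0 : R).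
Proof.
have [[Dw V0w]|Dw] := pselect (telegraph_nonneg N V0 t w /\ V0 w = c); last first.
  apply: cvg_near_cst; apply: nearW => r; rewrite /upper_defect g_off//.
  rewrite sub0r max_r ?mulr0// oppr_le0.
  by case/andP: (upper01 r w).
apply: (squeeze_cvgr _ (cvg_cst 0) (@cvg_payoff_gap w)).
(* For such r the barrier c h (r + 1) exceeds the discretisation error 2 c h N(t), so the word
   followed by a nonnegative path passes the test in [upper]. *)
exists (2 * N t w + 1)%N => // r /= hr.
rewrite /upper_defect mulr_ge0 ?le_max ?lexx ?orbT//; last by case/andP: (simple01 r w).
rewrite andTb.
have [[s [sm ws] E]|E] := grid_sum_cases (M r) (h r) w; rewrite /simple /upper !E; last by rewrite mul0r.
rewrite mul1r ge_max normr_ge0 andbT.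
have -> : above r.+1 s.
  apply/(grid_above r.+1 sm ws) => j jM.
  have jt : j%:R * h r <= t.
    by rewrite -(hM r) mulrC ler_wpM2l ?(ltW (h0 r))// ler_nat.
  have a0 : 0 <= j%:R * h r by rewrite mulr_ge0// ltW.
  have : 0 <= telegraph N V0 (j%:R * h r) w by apply: Dw; rewrite a0.
  have := path_sum_approx (V0 w) (@nd w) j (ltW (h0 r)).
  rewrite -/(X (h r) j w) -/(telegraph N V0 (j%:R * h r) w) ler_norml => /andP[_ L].
  have : 2 * `|V0 w| * h r * (N (j%:R * h r) w)%:R <= c * h r * r.+1%:R.
    rewrite V0w (gtr0_norm c0).
    have -> : 2 * c * h r * (N (j%:R * h r) w)%:R = c * h r * (2 * N (j%:R * h r)%R w)%:R.
      by rewrite natrM; ring.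
    apply: ler_wpM2l; first exact: mulr_ge0 (ltW c0) (ltW (h0 r)).
    rewrite ler_nat.
    by have := nd w a0 jt; lia.
  by rewrite /telegraph/velocity in L *; lra.
by rewrite g_on// mulr1 (grid_payoff sm ws) distrC ler_norm.
Qed.

Let int01 K (f : Omega -> R) : measurable_fun setT f ->
  (forall w, 0 <= f w <= K) -> P.-integrable setT (EFin \o f).
Proof.
move=> mf fK; apply: (@bounded_integrable _ _ _ _ _ K) => // w.
by have /andP[f0 f1] := fK w; rewrite ger0_norm.
Qed.

Let mlower r : measurable_fun setT (lower r).
Proof. exact: measurable_grid_sum (ltW (h0 r)). Qed.

Let mupper r : measurable_fun setT (upper r).
Proof. exact: measurable_grid_sum (ltW (h0 r)). Qed.

Let msimple r : measurable_fun setT (simple r).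
Proof. exact: measurable_grid_sum (ltW (h0 r)). Qed.

Let mexcess r : measurable_fun setT (lower_excess r).
Proof. by apply: measurable_maxr => //; exact: measurable_funB. Qed.

Let mdefect r : measurable_fun setT (upper_defect r).
Proof.
by apply: measurable_funM => //; apply: measurable_maxr => //; exact: measurable_funB.
Qed.

Let excess01 r w : 0 <= lower_excess r w <= bound.
Proof.
rewrite /lower_excess le_max lexx orbT/= ge_max bound0 andbT.
by have := g01 w; have := lower01 r w; lra.
Qed.

Let defect01 r w : 0 <= upper_defect r w <= bound.
Proof.
have H : 0 <= Num.max (g w - upper r w) 0 <= bound.
  rewrite le_max lexx orbT/= ge_max bound0 andbT.
  by have := g01 w; have := upper01 r w; lra.
rewrite /upper_defect; have [[s _ E]|E] := grid_sum_cases (M r) (h r) w; rewrite /simple E.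
  by rewrite mul1r.
by rewrite mul0r lexx bound0.
Qed.

Let lower_bound : meander_mass <= \int[P]_w g w.
Proof.
have c1 : (\int[P]_w g w + \int[P]_w lower_excess r w) @[r --> \oo] --> \int[P]_w g w + 0.
  apply: cvgD; first exact: cvg_cst.
  apply: (@bounded_cvg0 _ _ _ _ _ bound) => // r w.
  by have /andP[f0 f1] := excess01 r w; rewrite ger0_norm.
rewrite addr0 in c1; apply: (ler_cvg_to cvg_lower c1); apply: nearW => r.
rewrite -RintegralD//; last 2 first.
- exact: int01 g01.
- exact: int01 (excess01 r).
apply: le_Rintegral => //.
- exact: int01 (lower01 r).
- have i1 := int01 measurable_g g01; have i2 := int01 (mexcess r) (excess01 r).
  exact: (integrableD measurableT i1 i2).
- by move=> w _; rewrite -lerBlDl /lower_excess le_max lexx.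
Qed.

Let upper_bound : \int[P]_w g w <= meander_mass.
Proof.
have [mV PV _] := V0U.
have mEc : measurable [set w | V0 w = c].
  have -> : [set w | V0 w = c] = setT `&` V0 @^-1` [set c].
    by apply/seteqP; split => w //= [].
  exact: mV.
pose ind w : R := \1_[set w | V0 w = c] w.
have mind : measurable_fun setT ind by exact: measurable_indic.
have ind01 w : 0 <= ind w <= 1 by rewrite /ind indicE; case: (_ \in _); rewrite ?lexx ler01.
(* Pointwise, g is at most [upper] plus [upper_defect], except on paths with V0 = c that follow no
   word. There g is at most [bound], and their probability is 1/2 minus the mass of [simple]. *)
have c1 : (upper_sum r + \int[P]_w upper_defect r w +
    bound * (2^-1 - \int[P]_w simple r w)) @[r --> \oo] --> meander_mass + 0 + bound * (2^-1 - 2^-1).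
  apply: cvgD.
    apply: cvgD; first exact: cvg_upper_sum.
    apply: (@bounded_cvg0 _ _ _ _ _ bound) => // r w.
    by have /andP[f0 f1] := defect01 r w; rewrite ger0_norm.
  apply: cvgM; first exact: cvg_cst.
  by apply: cvgB; [exact: cvg_cst|exact: cvg_simple].
rewrite subrr mulr0 !addr0 in c1.
apply: (ler_cvg_to (cvg_cst _) c1); apply: nearW => r.
have iu := int01 (mupper r) (upper01 r); have iD := int01 (mdefect r) (defect01 r).
have isx := int01 (msimple r) (simple01 r); have ii := int01 mind ind01.
have Pind : \int[P]_w ind w = 2^-1.
  by rewrite /Rintegral integral_indic// setIT; transitivity (fine (P [set w | V0 w = c])) => //; rewrite PV.
have iB : P.-integrable setT (EFin \o (fun w => ind w - simple r w)).
  exact: (integrableB measurableT ii isx).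
have iZ : P.-integrable setT (EFin \o (fun w => bound * (ind w - simple r w))).
  by have := integrableZl measurableT bound iB.
have iuD : P.-integrable setT (EFin \o (fun w => upper r w + upper_defect r w)).
  exact: (integrableD measurableT iu iD).
apply: (@le_trans _ _ (\int[P]_w upper r w + \int[P]_w upper_defect r w +
    bound * (2^-1 - \int[P]_w simple r w))); last by rewrite !lerD2r upper_le.
rewrite -Pind -RintegralB// -RintegralZl// -RintegralD// -RintegralD//.
apply: le_Rintegral => //.
- exact: int01 g01.
- exact: (integrableD measurableT iuD iZ).
move=> w _; rewrite /upper_defect.
have H : g w - upper r w <= Num.max (g w - upper r w) 0 by rewrite le_max lexx.
have ug := upper01 r w; have gg := g01 w.
have [[s [_ [V0w _]] E]|E] := grid_sum_cases (M r) (h r) w.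
  have -> : simple r w = 1 by rewrite /simple E.
  rewrite /ind indicE mem_set// subrr mulr0 addr0 mul1r; lra.
have -> : simple r w = 0 by rewrite /simple E.
rewrite mul0r addr0 subr0 /ind indicE.
have [V0w|V0w] := pselect (V0 w = c).
  by rewrite mem_set// mulr1; lra.
rewrite memNset// mulr0 addr0 g_off; first by case/andP: ug.
by case.
Qed.

(** Right continuity of N at 0 gives a switch-free interval [0, b]; velocity -c on it would force
    T(b) = - c b < 0. *)
Let initially_falling w : telegraph_nonneg N V0 t w -> V0 w <> - c.
Proof.
move=> Dw V0w; have := poisson_right_continuous NP w (lexx 0).
move=> [e /= e0 He]; pose b := Num.min (e / 2) t.
have b0 : 0 < b by rewrite lt_min t0 andbT divr_gt0.
have Nb : N b w = 0%N.
  rewrite -(n0 w); apply: He => //=.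
  rewrite sub0r normrN gtr0_norm// (@le_lt_trans _ _ (e / 2)) ?ge_min ?lexx//.
  by rewrite ltr_pdivrMr// ltr_pMr// ltr1n.
have := telegraph_local (V0 w) (@nd w) (lexx 0) (ltW b0).
rewrite Nb n0 subn0 mulr0 expr0 normr_le0 subr0 => /eqP H.
have Tb : 0 <= telegraph N V0 b w by apply: Dw; rewrite (ltW b0) ge_min lexx orbT.
have T0 : telegraph N V0 0 w = 0 by exact: telegraph0.
have : telegraph N V0 b w - telegraph N V0 0 w - b * (V0 w * 1) = 0 by exact: H.
rewrite T0 V0w => H'.
have : 0 < b * c by rewrite mulr_gt0.
lra.
Qed.

Lemma integral_telegraph_nonneg :
  (\int[P]_(w in telegraph_nonneg N V0 t) (pospow p (telegraph N V0 t w))%:E =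
   (2^-1 * expR (- (lambda * t)) *
     (pospow p (c * t) * meander_series p (lambda * t)))%:E)%E.
Proof.
have -> : 2^-1 * expR (- (lambda * t)) *
     (pospow p (c * t) * meander_series p (lambda * t)) = \int[P]_w g w.
  by apply/eqP; rewrite eq_le lower_bound upper_bound.
have gfin : (\int[P]_w (g w)%:E)%E \is a fin_num.
  by apply: integrable_fin_num => //; exact: int01 g01.
rewrite /Rintegral fineK//.
have mD := measurable_telegraph_nonneg (ltW t0).
have [mV PV PV'] := V0U.
have mE (a : R) : measurable [set w | V0 w = a].
  have -> : [set w | V0 w = a] = setT `&` V0 @^-1` [set a].
    by apply/seteqP; split => w //= [].
  exact: mV.
have mf : measurable_fun setT (fun w => (pospow p (telegraph N V0 t w))%:E).
  apply: measurableT_comp => //; apply: measurableT_comp; last exact: measurable_telegraph (ltW t0).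
  by apply: continuous_measurable_fun; exact: continuous_pospow.
rewrite [LHS]integral_mkcond; apply: ae_eq_integral => //.
- by apply/(measurable_restrictT _ mD).1; exact: measurable_funTS.
- by apply: measurableT_comp.
(* V0 takes the values c and -c only almost surely, so the integrand and g are compared outside a
   null set. *)
pose S := [set w | V0 w = c] `|` [set w | V0 w = - c].
have mS : measurable S by exact: measurableU.
exists (~` S); split.
- exact: measurableC.
- transitivity (P (~` S)) => //; rewrite probability_setC//.
  have -> : P S = (P [set w | V0 w = c] + P [set w | V0 w = (- c)%R])%E.
    rewrite /S measureU//; apply/seteqP; split => w //= [-> e].
    by have := c0; lra.
  have half : 2^-1 + 2^-1 = 1 :> R by lra.
  by rewrite PV PV' -EFinD half subrr.
apply: subsetC => w /= Vw _; rewrite patchE; case: ifPn => Dw.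
  move: Dw; rewrite inE => Dw; rewrite g_on//.
  by case: Vw => // /(initially_falling Dw).
by rewrite g_off// => -[Dw' _]; move/negP: Dw; apply; rewrite inE.
Qed.

End telegraph_law.

(** * The meander *)

Section meander.
Context {R : realType} {d d' : measure_display}.
Context {Omega : measurableType d} {Omega' : measurableType d'}.
Variables (P : probability Omega R) (P' : probability Omega' R).
Variables (N : R -> Omega -> nat) (V0 : Omega -> R) (t : R) (Tp : R -> Omega' -> R).
Hypothesis t0 : 0 <= t.
Hypothesis mT : measurable_fun setT (telegraph N V0 t).
Hypothesis mD : measurable (telegraph_nonneg N V0 t).
Hypothesis meander : telegraph_meander P N V0 t P' Tp.

Let D := telegraph_nonneg N V0 t.
Let T := telegraph N V0 t.

Let mTp : measurable_fun setT (Tp t).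
Proof. by apply: (meander_measurable meander); rewrite t0 lexx. Qed.

Lemma meander_end_law (A : set R) : measurable A ->
  P' (Tp t @^-1` A) = (P ((T @^-1` A) `&` D) / P D)%E.
Proof.
move=> mA; apply: (meander_law meander (C := [set f | A (f t)])).
apply: sub_gen_smallest; exists t; first by rewrite /= in_itv/= t0 lexx.
by exists A.
Qed.

Let T_ge0 w : D w -> 0 <= T w.
Proof. by apply; rewrite t0 lexx. Qed.

(* Off [D] the value -1 keeps [Y] outside [0, +oo[. *)
Let Y w : R := T w * \1_D w + (\1_D w - 1).

Let mY : measurable_fun setT Y.
Proof.
have mI : measurable_fun setT (\1_D : Omega -> R) by exact: measurable_indic.
apply: measurable_funD; first exact: measurable_funM.
exact: measurable_funB.
Qed.

Let Y_on w : D w -> Y w = T w.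
Proof. by move=> Dw; rewrite /Y indicE mem_set// mulr1 subrr addr0. Qed.

Let Y_off w : ~ D w -> Y w = - 1.
Proof. by move=> Dw; rewrite /Y indicE memNset// mulr0 add0r sub0r. Qed.

Let YP (A : set R) : A `<=` `[0, +oo[ -> Y @^-1` A = (T @^-1` A) `&` D.
Proof.
move=> A0; apply/seteqP; split => w /=; last by move=> [AT Dw]; rewrite Y_on.
have [Dw|Dw] := pselect (D w); first by rewrite Y_on.
by rewrite Y_off// => /A0; rewrite /= in_itv/= andbT; lra.
Qed.

(** Both integrals are pushed forward to [0, +oo[, where the law of [Tp t] is that of [Y] divided by
    [P D]. The half-line has to be reached first, because [Tp t] is nonnegative only almost
    surely. *)
Lemma expectation_meander (F : R -> R) : measurable_fun setT F -> (forall x, 0 <= F x) ->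
  (0 < P D)%E ->
  (\int[P']_w (F (Tp t w))%:E = (fine (P D))^-1%:E * \int[P]_(w in D) (F (T w))%:E)%E.
Proof.
move=> mF F0 PD0.
have mFT d0 (S : measurableType d0) (Z : S -> R) : measurable_fun setT Z ->
    measurable_fun setT (fun w => (F (Z w))%:E).
  by move=> mZ; apply: measurableT_comp => //; exact: measurableT_comp.
have mFE : measurable_fun (`[0%R, +oo[%classic : set R) (EFin \o F).
  by apply: measurable_funTS; exact: measurableT_comp.
have PDfin : P D \is a fin_num by exact: fin_num_measure.
have fPD : 0 < fine (P D) by rewrite fine_gt0// PD0 ltey_eq PDfin.
have k0 : 0 <= (fine (P D))^-1 by rewrite invr_ge0 ltW.
have mneg : measurable (`]-oo, 0[%classic : set R) by exact: measurable_itv.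
rewrite (@ge0_negligible_integral _ _ _ P' setT (Tp t @^-1` `]-oo, 0[%classic))//; last 4 first.
- by rewrite -[X in measurable X]setTI; exact: mTp.
- exact: mFT.
- by move=> w _; rewrite lee_fin.
- transitivity (P' (Tp t @^-1` `]-oo, 0[%classic)) => //.
  rewrite meander_end_law// (_ : _ `&` D = set0) ?measure0 ?mul0e//.
  apply/seteqP; split => w //= [+ /T_ge0]; rewrite in_itv/=; lra.
have -> : setT `\` Tp t @^-1` `]-oo, 0[%classic = Tp t @^-1` `[0, +oo[%classic.
  apply/seteqP; split => w /=; rewrite !in_itv/= andbT.
    by move=> [_ /negP]; rewrite -leNgt.
  by move=> h; split => //; rewrite ltNge h.
have -> : (\int[P]_(w in D) (F (T w))%:E = \int[P]_(w in Y @^-1` `[0%R, +oo[) (F (Y w))%:E)%E.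
  rewrite YP// (_ : _ `&` D = D); last first.
    by apply/setIidPr => w /T_ge0; rewrite /= in_itv/= andbT.
  by apply: eq_integral => w; rewrite inE => Dw; rewrite Y_on.
rewrite -(@ge0_integral_pushforward _ _ _ _ _ (Tp t) mTp P' `[0, +oo[%classic (EFin \o F))//; last first.
  by move=> y _; rewrite lee_fin.
rewrite -(@ge0_integral_pushforward _ _ _ _ _ Y mY P `[0, +oo[%classic (EFin \o F))//; last first.
  by move=> y _; rewrite lee_fin.
rewrite -(@ge0_integral_mscale _ _ _ _ _ _ (NngNum k0))//; last first.
  by move=> y _; rewrite lee_fin.
apply: eq_measure_integral => A mA A0.
rewrite /mscale/= /pushforward meander_end_law// muleC; congr (_ * P _)%E; last by rewrite YP.

by rewrite -[in LHS](fineK PDfin) inver gt_eqF.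
Qed.

End meander.

Theorem proposition3p2 (R : realType) (lambda c t : R)
    (d : measure_display) (Omega : measurableType d) (P : probability Omega R)
    (N : R -> Omega -> nat) (V0 : Omega -> R)
    (d' : measure_display) (Omega' : measurableType d')
    (P' : probability Omega' R) (Tp : R -> Omega' -> R)
    (lambda_gt0 : 0 < lambda) (c_gt0 : 0 < c) (t_gt0 : 0 < t)
    (N_poisson : poisson_process P lambda N)
    (V0_uniform : uniform_sign P c V0)
    (V0_N_independent : independent_of_process P V0 N)
    (Tp_meander : telegraph_meander P N V0 t P' Tp) :
  forall p : R, 0 < p ->
  ('E_P'[fun w => (Tp t w `^ p)%R])%E =
  ((2 * c ^+ 2 * t / lambda) `^ (p / 2) *
   ((Gamma (p / 2 + 1) *
       (besselI (p / 2) (lambda * t) + besselI (p / 2 - 1) (lambda * t)) -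
     p / 2 * Gamma ((p + 1) / 2) * Num.sqrt (2 / (lambda * t)) *
       besselI ((p - 1) / 2) (lambda * t)) /
    (besselI 0 (lambda * t) + besselI 1 (lambda * t))))%:E.
Proof.
move=> p p_gt0.
have t_ge0 := ltW t_gt0; have x_gt0 : 0 < lambda * t by exact: mulr_gt0.
have mT := measurable_telegraph N_poisson V0_uniform t_ge0.
have mD := measurable_telegraph_nonneg N_poisson V0_uniform t_ge0.
have y_gt0 : 0 < lambda * t / 2 by rewrite divr_gt0.
have I_gt0 : 0 < besselI 0 (lambda * t) + besselI 1 (lambda * t).
  by rewrite addr_gt0// besselI_gt0//; lra.
have PDE : P (telegraph_nonneg N V0 t) =
    (2^-1 * expR (- (lambda * t)) * (besselI 0 (lambda * t) + besselI 1 (lambda * t)))%:E.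
  (* At exponent 0 the integrand is the constant 1, so the moment formula gives the probability of
     the conditioning event. *)
  have := integral_telegraph_nonneg lambda_gt0 c_gt0 N_poisson V0_uniform
    V0_N_independent t_gt0 (lexx 0).
  rewrite meander_series0E// [pospow 0 _]powRr0 mul1r => <-.
  rewrite (eq_integral (cst 1%E)) => [|w _]; last by rewrite /pospow powRr0.
  by rewrite integral_cst// mul1e.
have PD_gt0 : (0 < P (telegraph_nonneg N V0 t))%E.
  by rewrite PDE lte_fin !mulr_gt0 ?expR_gt0.
have mpow : measurable_fun setT (fun x : R => x `^ p) by exact: measurable_powR.
rewrite unlock.
have -> := expectation_meander t_ge0 mT mD Tp_meander mpow (fun x => powR_ge0 x p) PD_gt0.
rewrite (eq_integral (fun w => (pospow p (telegraph N V0 t w))%:E)) => [|w]; last first.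
  by rewrite inE => Dw; rewrite pospowE//; apply: Dw; rewrite t_ge0 lexx.
rewrite (integral_telegraph_nonneg lambda_gt0 c_gt0 N_poisson V0_uniform
  V0_N_independent t_gt0 (ltW p_gt0)) PDE -EFinM; congr EFin.
rewrite meander_seriesE// pospowE; last by rewrite mulr_ge0// ltW.
have powV q : (lambda * t / 2)^-1 `^ q = (lambda * t / 2) `^ (- q).
  by rewrite -(@powR_inv1 _ (lambda * t / 2)) ?(ltW y_gt0)// -powRrM mulN1r.
rewrite -[2 / (lambda * t)]invf_div -powR12_sqrt ?invr_ge0 ?(ltW y_gt0)// powV.
(* The prefactor of the statement thus splits into (ct)^p, the scale of the walk, and (lambda t /
   2)^(-p/2), the prefactor in [meander_seriesE]. *)
have -> : 2 * c ^+ 2 * t / lambda = (c * t) ^+ 2 / (lambda * t / 2).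
  by field; rewrite !gt_eqF.
rewrite [(_ ^+ 2 / _) `^ _]powRM ?invr_ge0 ?(ltW y_gt0) ?sqr_ge0//.
have -> : ((c * t) ^+ 2) `^ (p / 2) = (c * t) `^ p.
  rewrite -powR_mulrn ?mulr_ge0 ?(ltW c_gt0)// -powRrM; congr (_ `^ _); lra.
rewrite powV.
by rewrite /=; field; rewrite !gt_eqF ?expR_gt0.
Qed.
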